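(* (i) There is an isomorphism $S(\pi)\to T(\pi)$ of $\mathbb{Q}$-algebras sending $e_i$ to $e_i$, $f_i$ to $f_i$ ($1\le i\le n$), and $1_\lambda$ to $1_\lambda$ ($\lambda\in W\pi$). (ii) This isomorphism carries ${}_{\mathbb{Z}}S(\pi)$ onto ${}_{\mathbb{Z}}T(\pi)$, where ${}_{\mathbb{Z}}T(\pi)$ is identified with the $\mathbb{Z}$-submodule of $T(\pi)$ spanned by all elements $1\otimes x$ with $x\in{}_{\mathbb{Z}}T(\pi)$.
   Context: Root data. Let $(a_{ij})_{1\le i,j\le n}$ be a Cartan matrix of finite type (not assumed indecomposable): integers with $a_{ii}=2$, $a_{ij}\le 0$ for $i\ne j$, and there are $d_i\in\{1,2,3\}$ with $(d_ia_{ij})$ symmetric and positive definite. Let $\mathfrak{g}$ be the corresponding semisimple Lie algebra over $\mathbb{Q}$, $\mathfrak{h}$ its Cartan subalgebra, $\alpha_i\in\mathfrak{h}^*$ the simple roots, $\alpha_i^\vee\in\mathfrak{h}$ the simple coroots, $\langle\alpha_i^\vee,\alpha_j\rangle=a_{ij}$, $W$ the Weyl group. Let $X=\{\lambda\in\mathfrak{h}^*\mid\langle\alpha_i^\vee,\lambda\rangle\in\mathbb{Z}\ \forall i\}$, $X^+=\{\lambda\in X\mid\langle\alpha_i^\vee,\lambda\rangle\ge0\ \forall i\}$, and write $\lambda\le\mu$ if $\mu-\lambda\in\sum_i\mathbb{N}\alpha_i$. Let $\pi\subset X^+$ be a finite saturated set, i.e. $\mu\in\pi$, $\lambda\in X^+$,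 $\lambda\le\mu$ imply $\lambda\in\pi$. Let $W\pi=\{w\mu\mid w\in W,\mu\in\pi\}$. The algebra $S(\pi)$. It is the associative unital $\mathbb{Q}$-algebra with generators $e_i,f_i$ ($1\le i\le n$), $1_\lambda$ ($\lambda\in W\pi$) and relations: $1_\lambda1_\mu=\delta_{\lambda\mu}1_\lambda$, $\sum_{\lambda\in W\pi}1_\lambda=1$; $e_if_j-f_je_i=\delta_{ij}\sum_{\lambda\in W\pi}\langle\alpha_i^\vee,\lambda\rangle1_\lambda$; $e_i1_\lambda=1_{\lambda+\alpha_i}e_i$ if $\lambda+\alpha_i\in W\pi$ and $e_i1_\lambda=0$ otherwise; $f_i1_\lambda=1_{\lambda-\alpha_i}f_i$ if $\lambda-\alpha_i\in W\pi$ and $f_i1_\lambda=0$ otherwise; $1_\lambda e_i=e_i1_{\lambda-\alpha_i}$ if $\lambda-\alpha_i\in W\pi$ and $1_\lambda e_i=0$ otherwise; $1_\lambda f_i=f_i1_{\lambda+\alpha_i}$ if $\lambda+\alpha_i\in W\pi$ and $1_\lambda f_i=0$ otherwise; and for $i\ne j$ the Serre relations $\sum_{s=0}^{1-a_{ij}}(-1)^s\binom{1-a_{ij}}{s}e_i^{1-a_{ij}-s}e_je_i^s=0$ and the same with $f$ in place of $e$. ${}_{\mathbb{Z}}S(\pi)$ is the subring of $S(\pi)$ generated by the divided powers $e_i^m/m!$, $f_i^m/m!$ ($1\le i\le n$, $m\ge0$). The algebra ${}_{\mathbb{Z}}T(\pi)$. It is the associative unital $\mathbb{Z}$-algebra with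 generators $e_i^{(a)},f_i^{(b)}$ ($1\le i\le n$, $a,b\ge0$), $1_\lambda$ ($\lambda\in W\pi$) and the following relations, where by convention $1_\mu=0$ for $\mu\in X\setminus W\pi$, $e_i^{(m)}=f_i^{(m)}=0$ for $m<0$, and $\binom{a}{t}=a(a-1)\cdots(a-t+1)/t!$ for $a\in\mathbb{Z}$, $t\in\mathbb{N}$: $1_\lambda1_\mu=\delta_{\lambda\mu}1_\lambda$, $\sum_{\lambda\in W\pi}1_\lambda=1$; $e_i^{(a)}e_i^{(b)}=\binom{a+b}{a}e_i^{(a+b)}$, $f_i^{(a)}f_i^{(b)}=\binom{a+b}{a}f_i^{(a+b)}$, $e_i^{(0)}=f_i^{(0)}=1$; $e_i^{(a)}f_j^{(b)}=f_j^{(b)}e_i^{(a)}$ ($i\ne j$); $e_i^{(a)}1_{-\lambda}f_i^{(b)}=\sum_{t\ge0}\binom{a+b-\langle\alpha_i^\vee,\lambda\rangle}{t}f_i^{(b-t)}1_{-\lambda+(a+b-t)\alpha_i}e_i^{(a-t)}$; $f_i^{(b)}1_\lambda e_i^{(a)}=\sum_{t\ge0}\binom{a+b-\langle\alpha_i^\vee,\lambda\rangle}{t}e_i^{(a-t)}1_{\lambda-(a+b-t)\alpha_i}f_i^{(b-t)}$; $e_i^{(a)}1_\lambda=1_{\lambda+a\alpha_i}e_i^{(a)}$ if $\lambda+a\alpha_i\in W\pi$, and $0$ otherwise; $f_i^{(b)}1_\lambda=1_{\lambda-b\alpha_i}f_i^{(b)}$ if $\lambda-b\alpha_i\in W\pi$,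 and $0$ otherwise; $1_\lambda e_i^{(a)}=e_i^{(a)}1_{\lambda-a\alpha_i}$ if $\lambda-a\alpha_i\in W\pi$, and $0$ otherwise; $1_\lambda f_i^{(b)}=f_i^{(b)}1_{\lambda+b\alpha_i}$ if $\lambda+b\alpha_i\in W\pi$, and $0$ otherwise; and for $i\ne j$: $\sum_{s=0}^{1-a_{ij}}(-1)^se_i^{(1-a_{ij}-s)}e_j^{(1)}e_i^{(s)}=0$ and $\sum_{s=0}^{1-a_{ij}}(-1)^sf_i^{(1-a_{ij}-s)}f_j^{(1)}f_i^{(s)}=0$. $T(\pi)=\mathbb{Q}\otimes_{\mathbb{Z}}{}_{\mathbb{Z}}T(\pi)$; in $T(\pi)$ write $e_i=e_i^{(1)}$, $f_i=f_i^{(1)}$. *)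

(* Defs.v *)
From HB Require Import structures.
From mathcomp Require Import all_boot all_order all_algebra finmap.
From mathcomp Require Import all_classical.
From mathcomp.multinomials Require Import monalg.

Set Implicit Arguments.
Unset Strict Implicit.
Unset Printing Implicit Defensive.

Import Order.TTheory GRing.Theory Num.Theory.

Local Open Scope classical_set_scope.
Local Open Scope ring_scope.
Local Open Scope quotient_scope.

Section GeneratedSubgroup.
Variable V : zmodType.

Inductive zspan (P : set V) : set V :=
| zspan_gen x of P x : zspan P x
| zspan0 : zspan P 0
| zspanB x y of zspan P x & zspan P y : zspan P (x - y).

Definition zspan_pred (P : set V) : V -> bool := fun x => `[< zspan P x >].

Lemma zspan_closed P : zmod_closed (zspan_pred P).
Proof.
split=> [|x y]; first exact/asboolP/zspan0.
by move=> /asboolP Px /asboolP Py; apply/asboolP/zspanB.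
Qed.

HB.instance Definition _ P :=
  GRing.isZmodClosed.Build V (zspan_pred P) (zspan_closed P).

End GeneratedSubgroup.

Inductive subring_gen (R : pzRingType) (P : set R) : set R :=
| subring_gen_gen x of P x : subring_gen P x
| subring_gen1 : subring_gen P 1
| subring_genB x y of subring_gen P x & subring_gen P y :
    subring_gen P (x - y)
| subring_genM x y of subring_gen P x & subring_gen P y :
    subring_gen P (x * y).

(* The two-sided ideal generated by the differences x - y with [rel x y]. *)
Inductive ideal_gen (R : pzRingType) (rel : R -> R -> Prop) : set R :=
| ideal_gen_gen x y of rel x y : ideal_gen rel (x - y)
| ideal_gen0 : ideal_gen rel 0
| ideal_genB x y of ideal_gen rel x & ideal_gen rel y : ideal_gen rel (x - y)
| ideal_genMl a x of ideal_gen rel x : ideal_gen rel (a * x)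
| ideal_genMr a x of ideal_gen rel x : ideal_gen rel (x * a).

(* Associative unital K-algebras given by generators and relations.  The zero *)
(* algebra can occur, so these are pzRingTypes with an lmodType structure and *)
(* not algTypes, which are nontrivial by definition; [presalg_scaleAl] and    *)
(* [presalg_scaleAr] are the algebra laws.                                    *)
Notation freealg K G := {malg K[{fmonom G}]} (only parsing).

Section PresentedAlgebra.
Variables (K : comNzRingType) (G : choiceType).
Local Notation F := (freealg K G).

Definition freegen (g : G) : F := mkmalgU (fmu g) 1.

Lemma freealg_scaleAr (c : K) (x y : F) : c *: (x * y) = x * (c *: y).
Proof.
have Cx : GRing.comm (c%:MP : F) x.
  rewrite [x]monalgE; apply: commr_sum => k _; set d := mcoeff k x.
  have -> : GRing.comm (c%:MP : F) (mkmalgU k d) =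
      (mkmalgU (mmul mone k) (c * d) = mkmalgU (mmul k mone) (d * c) :> F).
    by rewrite -!fgmulUU.
  by rewrite mul1m mulm1 mulrC.
rewrite -[LHS]mul_malgC.
rewrite -[c *: y]mul_malgC.
rewrite mulrA.
rewrite Cx.
exact: esym (mulrA _ _ _).
Qed.

Variable rel : F -> F -> Prop.

Definition relideal : F -> bool := fun x => `[< ideal_gen rel x >].

Lemma relideal_closed : zmod_closed relideal.
Proof.
split=> [|x y]; first exact/asboolP/ideal_gen0.
by move=> /asboolP Px /asboolP Py; apply/asboolP/ideal_genB.
Qed.

HB.instance Definition _ :=
  GRing.isZmodClosed.Build F relideal relideal_closed.

Lemma relidealD x y :
  x \in relideal -> y \in relideal -> x + y \in relideal.
Proof. exact: (@rpredD _ (GRing.ZmodClosed.clone F relideal _) x y). Qed.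

Lemma relidealMl a x : x \in relideal -> a * x \in relideal.
Proof. by move=> /asboolP Px; apply/asboolP/ideal_genMl. Qed.

Lemma relidealMr a x : x \in relideal -> x * a \in relideal.
Proof. by move=> /asboolP Px; apply/asboolP/ideal_genMr. Qed.

Lemma relidealZ c x : x \in relideal -> c *: x \in relideal.
Proof. by move=> Ix; rewrite -mul_malgC relidealMl. Qed.

Definition presalg := Quotient.quot (GRing.ZmodClosed.clone F relideal _).
HB.instance Definition _ := GRing.Zmodule.on presalg.
HB.instance Definition _ := Quotient.on presalg.

Definition prespi (x : F) : presalg := \pi_presalg x.

Lemma prespiP x y : reflect (prespi x = prespi y) (x - y \in relideal).
Proof. by rewrite Quotient.idealrBE; exact: eqP. Qed.

Lemma prespi_reprK (x : presalg) : prespi (repr x) = x.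
Proof. exact: reprK. Qed.

Lemma prespiD : {morph prespi : x y / x + y}.
Proof. exact: pi_addr. Qed.

Definition presone : presalg := prespi 1.
Definition presmul (x y : presalg) : presalg := prespi (repr x * repr y).
Definition presscale (c : K) (x : presalg) : presalg := prespi (c *: repr x).

Lemma presmulE x y : presmul (prespi x) (prespi y) = prespi (x * y).
Proof.
apply/prespiP; set x' := repr _; set y' := repr _.
have -> : x' * y' - x * y = (x' - x) * y' + x * (y' - y).
  by rewrite mulrBl mulrBr addrA subrK.
apply: relidealD; [apply: relidealMr | apply: relidealMl];
  by apply/prespiP; rewrite prespi_reprK.
Qed.

Lemma presscaleE c x : presscale c (prespi x) = prespi (c *: x).
Proof.
apply/prespiP; rewrite -scalerBr; apply: relidealZ.
by apply/prespiP; rewrite prespi_reprK.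
Qed.

Let presE := (presmulE, presscaleE, =^~ prespiD).
Let pres_ind (P : presalg -> Prop) :
  (forall x, P (prespi x)) -> forall x, P x.
Proof. by move=> IH x; rewrite -[x]prespi_reprK. Qed.

Lemma presmulA : associative presmul.
Proof.
elim/pres_ind=> x; elim/pres_ind=> y; elim/pres_ind=> z.
by rewrite !presE mulrA.
Qed.

Lemma presmul1 : left_id presone presmul.
Proof. by elim/pres_ind=> x; rewrite !presE mul1r. Qed.

Lemma pres1mul : right_id presone presmul.
Proof. by elim/pres_ind=> x; rewrite !presE mulr1. Qed.

Lemma presmulDl : left_distributive presmul +%R.
Proof.
elim/pres_ind=> x; elim/pres_ind=> y; elim/pres_ind=> z.
by rewrite !presE mulrDl.
Qed.

Lemma presmulDr : right_distributive presmul +%R.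
Proof.
elim/pres_ind=> x; elim/pres_ind=> y; elim/pres_ind=> z.
by rewrite !presE mulrDr.
Qed.

HB.instance Definition _ := GRing.Zmodule_isPzRing.Build presalg
  presmulA presmul1 pres1mul presmulDl presmulDr.

Lemma presscaleA a b x : presscale a (presscale b x) = presscale (a * b) x.
Proof. by elim/pres_ind: x => x; rewrite !presE scalerA. Qed.

Lemma presscale1 : left_id 1 presscale.
Proof. by elim/pres_ind=> x; rewrite !presE scale1r. Qed.

Lemma presscaleDr : right_distributive presscale +%R.
Proof.
by move=> c; elim/pres_ind=> x; elim/pres_ind=> y; rewrite !presE scalerDr.
Qed.

Lemma presscaleDl x : {morph presscale^~ x : a b / a + b}.
Proof. by move=> a b; elim/pres_ind: x => x; rewrite !presE scalerDl. Qed.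

HB.instance Definition _ := GRing.Zmodule_isLmodule.Build K presalg
  presscaleA presscale1 presscaleDr presscaleDl.

Lemma prespi_is_zmod_morphism : zmod_morphism prespi.
Proof. by move=> x y; rewrite /prespi raddfB. Qed.

Lemma prespi_is_monoid_morphism : monoid_morphism prespi.
Proof. by split=> [|x y]; [reflexivity | exact: esym (presmulE x y)]. Qed.

Lemma prespi_is_scalable : scalable prespi.
Proof. by move=> c x; exact: esym (presscaleE c x). Qed.

HB.instance Definition _ :=
  GRing.isZmodMorphism.Build F presalg prespi prespi_is_zmod_morphism.
HB.instance Definition _ :=
  GRing.isMonoidMorphism.Build F presalg prespi prespi_is_monoid_morphism.
HB.instance Definition _ :=
  GRing.isScalable.Build K F presalg *:%R prespi prespi_is_scalable.

Lemma presalg_scaleAl (c : K) (x y : presalg) : c *: (x * y) = c *: x * y.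
Proof.
elim/pres_ind: x => x; elim/pres_ind: y => y.
rewrite -[LHS]/(presscale c (presmul _ _)) -[RHS]/(presmul (presscale c _) _).
by rewrite !presE scalerAl.
Qed.

Lemma presalg_scaleAr (c : K) (x y : presalg) : c *: (x * y) = x * (c *: y).
Proof.
elim/pres_ind: x => x; elim/pres_ind: y => y.
rewrite -[LHS]/(presscale c (presmul _ _)) -[RHS]/(presmul _ (presscale c _)).
by rewrite !presE freealg_scaleAr.
Qed.

End PresentedAlgebra.

(* The tensor product over Z of two abelian groups: the free abelian group on *)
(* V * W modulo the subgroup generated by the bilinearity relations.          *)
Section TensorProduct.
Variables V W : zmodType.

Local Notation freeab := {malg int[(V * W)%type]}.

Definition freeabU (v : V) (w : W) : freeab := mkmalgU (v, w) 1.

Inductive bilinear_relator : set freeab :=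
| bilinear_relatorDl v1 v2 w :
    bilinear_relator (freeabU (v1 + v2) w - (freeabU v1 w + freeabU v2 w))
| bilinear_relatorDr v w1 w2 :
    bilinear_relator (freeabU v (w1 + w2) - (freeabU v w1 + freeabU v w2)).

Definition tensor :=
  Quotient.quot (GRing.ZmodClosed.clone freeab (zspan_pred bilinear_relator) _).
HB.instance Definition _ := GRing.Zmodule.on tensor.
HB.instance Definition _ := Quotient.on tensor.

Definition tenspi (x : freeab) : tensor := \pi_tensor x.

Definition tens (v : V) (w : W) : tensor := tenspi (freeabU v w).

Lemma tenspiP x y :
  reflect (tenspi x = tenspi y) (x - y \in zspan_pred bilinear_relator).
Proof. by rewrite Quotient.idealrBE; exact: eqP. Qed.

Lemma tenspiB : zmod_morphism tenspi.
Proof. by move=> x y; rewrite /tenspi raddfB. Qed.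

HB.instance Definition _ :=
  GRing.isZmodMorphism.Build freeab tensor tenspi tenspiB.

Lemma tensDl v1 v2 w : tens (v1 + v2) w = tens v1 w + tens v2 w.
Proof.
rewrite /tens -raddfD; apply/tenspiP/asboolP/zspan_gen.
exact: bilinear_relatorDl.
Qed.

Lemma tensDr v w1 w2 : tens v (w1 + w2) = tens v w1 + tens v w2.
Proof.
rewrite /tens -raddfD; apply/tenspiP/asboolP/zspan_gen.
exact: bilinear_relatorDr.
Qed.

Lemma tens_ind (P : tensor -> Prop) :
  (forall v w, P (tens v w)) ->
  (forall x y, P x -> P y -> P (x - y)) -> forall x, P x.
Proof.
move=> Pt PB x.
have P0 : P 0 by rewrite -(subrr (tens 0 0)); apply: PB.
have PN y : P y -> P (- y) by move=> Py; rewrite -sub0r; apply: PB.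
have PD y z : P y -> P z -> P (y + z).
  by move=> Py Pz; rewrite -[z]opprK; apply/PB/PN.
have PM y m : P y -> P (y *+ m).
  by move=> Py; elim: m => [|m IHm]; rewrite ?mulr0n // mulrS; apply: PD.
rewrite -[x]reprK -/(tenspi _) [repr x]monalgE raddf_sum /=.
apply: (big_ind P) => // -[v w] _; set c := mcoeff _ _.
have cE : mkmalgU (v, w) c = freeabU v w *~ c :> freeab.
  by rewrite /freeabU -raddfMz intz.
rewrite cE raddfMz /=; case: c {cE} => c; first by rewrite -pmulrn; apply/PM/Pt.
by rewrite NegzE mulrNz -pmulrn; apply/PN/PM/Pt.
Qed.

Section Lift.
Variables (U : zmodType) (h : V -> W -> U).
Hypothesis hDl : forall v1 v2 w, h (v1 + v2) w = h v1 w + h v2 w.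
Hypothesis hDr : forall v w1 w2, h v (w1 + w2) = h v w1 + h v w2.

Let freelift (x : freeab) : U := \sum_(k <- msupp x) h k.1 k.2 *~ mcoeff k x.

Let freeliftw (d : {fset (V * W)%type}) (x : freeab) : fsubset (msupp x) d ->
  freelift x = \sum_(k <- d) h k.1 k.2 *~ mcoeff k x.
Proof.
move=> le; rewrite [LHS](big_fset_incl _ le) => //= k _ /mcoeff_outdom ->.
by rewrite mulr0z.
Qed.

Let freeliftB x y : freelift (x - y) = freelift x - freelift y.
Proof.
pose d := fsetU (msupp x) (msupp y).
rewrite (@freeliftw d) ?msuppB_le // (@freeliftw d x) ?fsubsetUl //.
rewrite (@freeliftw d y) ?fsubsetUr // -sumrB; apply: eq_bigr => k _.
by rewrite mcoeffB mulrzBr.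
Qed.

Let freeliftU v w : freelift (freeabU v w) = h v w.
Proof.
rewrite (@freeliftw (fset1 (v, w))) ?msuppU_le //.
by rewrite big_seq_fset1 mcoeffUU mulr1z.
Qed.

Let freelift0 : freelift 0 = 0.
Proof. by rewrite -(subrr (0 : freeab)) freeliftB subrr. Qed.

Let freeliftD x y : freelift (x + y) = freelift x + freelift y.
Proof.
by rewrite -{1}[y]opprK freeliftB -[- y]sub0r freeliftB freelift0 sub0r opprK.
Qed.

Let freelift_ker x : zspan bilinear_relator x -> freelift x = 0.
Proof.
elim=> {x} [_ [v1 v2 w|v w1 w2]||x y _ fx _ fy].
- by rewrite freeliftB freeliftD !freeliftU hDl subrr.
- by rewrite freeliftB freeliftD !freeliftU hDr subrr.
- exact: freelift0.
- by rewrite freeliftB fx fy subrr.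
Qed.

Definition tens_lift (x : tensor) : U := freelift (repr x).

Let tens_liftE x : tens_lift (tenspi x) = freelift x.
Proof.
apply/eqP; rewrite -subr_eq0 -freeliftB; apply/eqP/freelift_ker.
exact/asboolP/tenspiP/reprK.
Qed.

Lemma tens_liftU v w : tens_lift (tens v w) = h v w.
Proof. by rewrite tens_liftE freeliftU. Qed.

Lemma tens_liftB : zmod_morphism tens_lift.
Proof.
move=> x y; rewrite -[x]reprK -[y]reprK -/(tenspi _) -/(tenspi (repr y)).
by rewrite -tenspiB !tens_liftE freeliftB.
Qed.

End Lift.

End TensorProduct.

(* The tensor product of two rings, with (a (x) b) * (a' (x) b') = aa' (x) bb' *)
(* (see [tensM]); it is a module over the left factor.                         *)
Section TensorRing.
Variables A B : pzRingType.
Implicit Types (a : A) (b : B) (x y z : tensor A B).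

Let mulU a b (y : tensor A B) : tensor A B :=
  tens_lift (fun a' b' => tens (a * a') (b * b')) y.

Let mulUU a b a' b' : mulU a b (tens a' b') = tens (a * a') (b * b').
Proof.
by rewrite /mulU tens_liftU // => *; rewrite ?mulrDr (tensDl, tensDr).
Qed.

Let mulUB a b : zmod_morphism (mulU a b).
Proof. by apply: tens_liftB => *; rewrite ?mulrDr (tensDl, tensDr). Qed.

Let addrBB (V : zmodType) (p q r s : V) : p + q - (r + s) = (p - r) + (q - s).
Proof. by rewrite opprD addrACA. Qed.

Let mulUDl a1 a2 b y : mulU (a1 + a2) b y = mulU a1 b y + mulU a2 b y.
Proof.
elim/tens_ind: y => [a' b'|x y IHx IHy]; last by rewrite !mulUB IHx IHy addrBB.
by rewrite !mulUU mulrDl tensDl.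
Qed.

Let mulUDr a b1 b2 y : mulU a (b1 + b2) y = mulU a b1 y + mulU a b2 y.
Proof.
elim/tens_ind: y => [a' b'|x y IHx IHy]; last by rewrite !mulUB IHx IHy addrBB.
by rewrite !mulUU mulrDl tensDr.
Qed.

Definition tensmul x y : tensor A B := tens_lift (fun a b => mulU a b y) x.

Let tensmulU a b y : tensmul (tens a b) y = mulU a b y.
Proof. by rewrite /tensmul tens_liftU. Qed.

Let tensmulBl y : zmod_morphism (tensmul^~ y).
Proof. by apply: tens_liftB. Qed.

Let tensmulBr x : zmod_morphism (tensmul x).
Proof.
move=> y z; elim/tens_ind: x => [a b|x x' IHx IHx'].
  by rewrite !tensmulU mulUB.
by rewrite !tensmulBl IHx IHx' !opprD !opprK addrACA.
Qed.

Let tensmulE a b a' b' :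
  tensmul (tens a b) (tens a' b') = tens (a * a') (b * b').
Proof. by rewrite tensmulU mulUU. Qed.

Lemma tensmulA : associative tensmul.
Proof.
move=> x y z.
elim/tens_ind: x => [a b|x x' IHx IHx']; last by rewrite !tensmulBl IHx IHx'.
elim/tens_ind: y => [a' b'|y y' IHy IHy'].
  elim/tens_ind: z => [a'' b''|z z' IHz IHz'].
    by rewrite !tensmulE !mulrA.
  by rewrite !tensmulBr IHz IHz'.
by rewrite tensmulBl !tensmulBr tensmulBl IHy IHy'.
Qed.

Lemma tensmul1 : left_id (tens 1 1) tensmul.
Proof.
by elim/tens_ind=> [a b|x y IHx IHy]; rewrite ?tensmulE ?mul1r // tensmulBr IHx IHy.
Qed.

Lemma tens1mul : right_id (tens 1 1) tensmul.
Proof.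
by elim/tens_ind=> [a b|x y IHx IHy]; rewrite ?tensmulE ?mulr1 // tensmulBl IHx IHy.
Qed.

Let morphD (V W : zmodType) (f : V -> W) :
  zmod_morphism f -> {morph f : x y / x + y}.
Proof.
move=> fB x y; have f0 : f 0 = 0 by rewrite -(subrr 0) fB subrr.
by rewrite -{1}[y]opprK fB -[- y]sub0r fB f0 sub0r opprK.
Qed.

Lemma tensmulDl : left_distributive tensmul +%R.
Proof. by move=> x y z; apply: (morphD (tensmulBl z)). Qed.

Lemma tensmulDr : right_distributive tensmul +%R.
Proof. by move=> x y z; apply: (morphD (tensmulBr x)). Qed.

HB.instance Definition _ := GRing.Zmodule_isPzRing.Build (tensor A B)
  tensmulA tensmul1 tens1mul tensmulDl tensmulDr.

Lemma tensM a b a' b' :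
  tens a b * tens a' b' = tens (a * a') (b * b') :> tensor A B.
Proof. exact: tensmulE. Qed.

Lemma tens11 : tens 1 1 = 1 :> tensor A B.
Proof. by []. Qed.

Definition tensscale a x : tensor A B := tens a 1 * x.

Lemma tensscaleA a a' x : tensscale a (tensscale a' x) = tensscale (a * a') x.
Proof. by rewrite /tensscale mulrA tensM mulr1. Qed.

Lemma tensscale1 : left_id 1 tensscale.
Proof. by move=> x; rewrite /tensscale mul1r. Qed.

Lemma tensscaleDr : right_distributive tensscale +%R.
Proof. by move=> a x y; rewrite /tensscale mulrDr. Qed.

Lemma tensscaleDl x : {morph tensscale^~ x : a a' / a + a'}.
Proof. by move=> a a'; rewrite /tensscale tensDl mulrDl. Qed.

HB.instance Definition _ := GRing.Zmodule_isLmodule.Build A (tensor A B)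
  tensscaleA tensscale1 tensscaleDr tensscaleDl.

Lemma tensZ a a' b : a *: tens a' b = tens (a * a') b :> tensor A B.
Proof. by rewrite [LHS]tensM mul1r. Qed.

End TensorRing.

Definition cartan_finite_type n (A : 'M[int]_n) : Prop :=
  [/\ forall i, A i i = 2,
      forall i j, i != j -> A i j <= 0
    & exists d : 'I_n -> int,
        [/\ forall i, d i \in [:: 1; 2; 3],
            forall i j, d i * A i j = d j * A j i
          & forall x : 'rV[rat]_n, x != 0 ->
              0 < \sum_i \sum_j (d i * A i j)%:~R * x 0 i * x 0 j]].

(* The coroots form a basis of h, so the weight lattice X is identified with  *)
(* Z^n by sending lambda to the vector of the integers <alpha_i^vee, lambda>. *)
(* Thus [l 0 i] is <alpha_i^vee, l>, and <alpha_i^vee, alpha_j> = A i j says  *)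
(* that alpha_j is the j-th column of A.                                      *)
Section Weights.
Variables (n : nat) (A : 'M[int]_n).

Definition weight := 'rV[int]_n.

Definition sroot (j : 'I_n) : weight := \row_i A i j.

Definition sreflection (i : 'I_n) (l : weight) : weight :=
  l - l 0 i *: sroot i.

(* Every element of the Weyl group is a product of simple reflections. *)
Definition weyl_act (w : seq 'I_n) (l : weight) : weight :=
  foldr sreflection l w.

Definition weyl_orbits (pi : set weight) : set weight :=
  [set l | exists w, exists2 m, pi m & l = weyl_act w m].

Definition dominant : set weight := [set l | forall i, 0 <= l 0 i].

Definition weight_le (l m : weight) : Prop :=
  exists c : 'I_n -> nat, m - l = \sum_i (c i)%:Z *: sroot i.

Definition saturated (pi : set weight) : Prop :=
  pi `<=` dominant /\
  forall l m, pi m -> dominant l -> weight_le l m -> pi l.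

(* 1 - a_ij, which is nonnegative for i != j. *)
Definition serre_exp (i j : 'I_n) : nat := `|1 - A i j|%N.

End Weights.

(* a (a - 1) ... (a - t + 1) / t!, an exact division. *)
Definition binz (a : int) (t : nat) : int :=
  ((\prod_(0 <= k < t) (a - k%:Z)) %/ t`!%:Z)%Z.

(* In both presentations the generators 1_l are indexed by W.pi, and          *)
(* [Sfree_one], [Tfree_one] extend l |-> 1_l to all weights by 0, so that one *)
(* equation covers both cases of each relation moving an idempotent past e_i  *)
(* or f_i.  W.pi is a finite set, hence the sums \sum_(l \in W.pi), which are *)
(* over finite supports, are the expected ones.                               *)
Section AlgebraS.
Variables (n : nat) (A : 'M[int]_n) (pi : set (weight n)).
Local Notation Wpi := (weyl_orbits A pi).
Local Notation alpha := (sroot A).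

Inductive Sgen := SgenE of 'I_n | SgenF of 'I_n | SgenOne of set_type Wpi.

HB.instance Definition _ := gen_eqMixin Sgen.
HB.instance Definition _ := gen_choiceMixin Sgen.

Local Notation F := (freealg rat Sgen).

Definition Sfree_e i : F := freegen rat (SgenE i).
Definition Sfree_f i : F := freegen rat (SgenF i).
Definition Sfree_one (l : weight n) : F :=
  if insub l is Some l' then freegen rat (SgenOne l') else 0.

Local Notation e := Sfree_e.
Local Notation f := Sfree_f.
Local Notation one := Sfree_one.

Inductive Srel : F -> F -> Prop :=
| Srel_idem l m of Wpi l & Wpi m :
    Srel (one l * one m) (if l == m then one l else 0)
| Srel_sum : Srel (\sum_(l \in Wpi) one l) 1
| Srel_ef i j :
    Srel (e i * f j - f j * e i)
         (if i == j then \sum_(l \in Wpi) (l 0 i)%:~R *: one l else 0)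
| Srel_eone i l of Wpi l : Srel (e i * one l) (one (l + alpha i) * e i)
| Srel_fone i l of Wpi l : Srel (f i * one l) (one (l - alpha i) * f i)
| Srel_onee i l of Wpi l : Srel (one l * e i) (e i * one (l - alpha i))
| Srel_onef i l of Wpi l : Srel (one l * f i) (f i * one (l + alpha i))
| Srel_serre_e (i j : 'I_n) of i != j : let m := serre_exp A i j in
    Srel (\sum_(s < m.+1)
            ((-1) ^+ s * 'C(m, s)%:R) *: (e i ^+ (m - s) * e j * e i ^+ s)) 0
| Srel_serre_f (i j : 'I_n) of i != j : let m := serre_exp A i j in
    Srel (\sum_(s < m.+1)
            ((-1) ^+ s * 'C(m, s)%:R) *: (f i ^+ (m - s) * f j * f i ^+ s)) 0.

Definition Salg := presalg Srel.
HB.instance Definition _ := GRing.PzRing.on Salg.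
HB.instance Definition _ := GRing.Lmodule.on Salg.

Definition Se (i : 'I_n) : Salg := prespi Srel (e i).
Definition Sf (i : 'I_n) : Salg := prespi Srel (f i).
Definition Sone (l : weight n) : Salg := prespi Srel (one l).

Definition ZS : set Salg :=
  subring_gen [set x | exists i (m : nat),
    x = m`!%:R^-1 *: Se i ^+ m \/ x = m`!%:R^-1 *: Sf i ^+ m].

End AlgebraS.

Arguments Srel {n} A pi _ _.
Arguments ZS {n} A pi _.

Section AlgebraT.
Variables (n : nat) (A : 'M[int]_n) (pi : set (weight n)).
Local Notation Wpi := (weyl_orbits A pi).
Local Notation alpha := (sroot A).

Inductive Tgen :=
  TgenE of 'I_n & nat | TgenF of 'I_n & nat | TgenOne of set_type Wpi.

HB.instance Definition _ := gen_eqMixin Tgen.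
HB.instance Definition _ := gen_choiceMixin Tgen.

Local Notation F := (freealg int Tgen).

Definition Tfree_e i a : F := freegen int (TgenE i a).
Definition Tfree_f i b : F := freegen int (TgenF i b).
Definition Tfree_one (l : weight n) : F :=
  if insub l is Some l' then freegen int (TgenOne l') else 0.

Local Notation e := Tfree_e.
Local Notation f := Tfree_f.
Local Notation one := Tfree_one.

(* In [Trel_eonef] and [Trel_fonee] the terms with t > min(a, b) contain a     *)
(* divided power of negative exponent, which is 0 by convention.  There l is   *)
(* an arbitrary weight, with 1_l = 0 outside W.pi.                             *)
Inductive Trel : F -> F -> Prop :=
| Trel_idem l m of Wpi l & Wpi m :
    Trel (one l * one m) (if l == m then one l else 0)
| Trel_sum : Trel (\sum_(l \in Wpi) one l) 1
| Trel_ee i a b : Trel (e i a * e i b) ('C(a + b, a)%:R *: e i (a + b)%N)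
| Trel_ff i a b : Trel (f i a * f i b) ('C(a + b, a)%:R *: f i (a + b)%N)
| Trel_e0 i : Trel (e i 0%N) 1
| Trel_f0 i : Trel (f i 0%N) 1
| Trel_ef (i j : 'I_n) a b of i != j : Trel (e i a * f j b) (f j b * e i a)
| Trel_eonef i a b (l : weight n) :
    Trel (e i a * one (- l) * f i b)
         (\sum_(t < (minn a b).+1)
            binz (a%:Z + b%:Z - l 0 i) t *:
              (f i (b - t)%N * one (- l + (a%:Z + b%:Z - t%:Z) *: alpha i)
                 * e i (a - t)%N))
| Trel_fonee i a b (l : weight n) :
    Trel (f i b * one l * e i a)
         (\sum_(t < (minn a b).+1)
            binz (a%:Z + b%:Z - l 0 i) t *:
              (e i (a - t)%N * one (l - (a%:Z + b%:Z - t%:Z) *: alpha i)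
                 * f i (b - t)%N))
| Trel_eone i a l of Wpi l :
    Trel (e i a * one l) (one (l + a%:Z *: alpha i) * e i a)
| Trel_fone i b l of Wpi l :
    Trel (f i b * one l) (one (l - b%:Z *: alpha i) * f i b)
| Trel_onee i a l of Wpi l :
    Trel (one l * e i a) (e i a * one (l - a%:Z *: alpha i))
| Trel_onef i b l of Wpi l :
    Trel (one l * f i b) (f i b * one (l + b%:Z *: alpha i))
| Trel_serre_e (i j : 'I_n) of i != j : let m := serre_exp A i j in
    Trel (\sum_(s < m.+1) (-1) ^+ s *: (e i (m - s)%N * e j 1%N * e i s)) 0
| Trel_serre_f (i j : 'I_n) of i != j : let m := serre_exp A i j in
    Trel (\sum_(s < m.+1) (-1) ^+ s *: (f i (m - s)%N * f j 1%N * f i s)) 0.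

Definition ZTalg := presalg Trel.
HB.instance Definition _ := GRing.PzRing.on ZTalg.

Definition Talg := tensor rat ZTalg.
HB.instance Definition _ := GRing.PzRing.on Talg.
HB.instance Definition _ := GRing.Lmodule.on Talg.

Definition Te (i : 'I_n) : Talg := tens 1 (prespi Trel (e i 1%N)).
Definition Tf (i : 'I_n) : Talg := tens 1 (prespi Trel (f i 1%N)).
Definition Tone (l : weight n) : Talg := tens 1 (prespi Trel (one l)).

Definition ZT : set Talg := zspan [set tens 1 x | x in [set: ZTalg]].

End AlgebraT.

Arguments Trel {n} A pi _ _.
Arguments ZT {n} A pi _.

(* Main.v *)
From HB Require Import structures.
Require Import Defs.
From mathcomp Require Import all_boot all_order all_algebra finmap.
From mathcomp Require Import all_classical.
From mathcomp.multinomials Require Import monalg.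
From mathcomp Require Import ring zify.

(** Both algebras are given by presentations, so the proof compares the two
    sets of relations.

    In S(pi), set e^(a) = e^a/a! and f^(b) = f^b/b!.  For a fixed i the elements
    e, f and h = ef - fe satisfy the sl2 relations, and 1_l is an eigenvector of
    h of eigenvalue <alpha^vee, l>; hence Kostant's formula
      e^(a) f^(b) 1_l = sum_t binom(a - b + <alpha^vee, l>, t)
                                f^(b-t) e^(a-t) 1_l
    ([kostant]).  Together with the rule moving the idempotents past powers of
    e and f this is exactly the family of relations of T(pi) that involve two
    divided powers around an idempotent; the other relations of T(pi) follow
    from those of S(pi) on dividing by factorials ([S_rels_T_rels]).
    Conversely, for a = b = 1 the same formula reads (ef - fe) 1_l =
    <alpha^vee, l> 1_l, so e^(1), f^(1) and the 1_l satisfy the relations of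
    S(pi) in T(pi) ([T_rels_S_rels]).  The
    universal properties give phi : S(pi) -> T(pi) and
    psi : ZT(pi) -> S(pi); the composite of psi with phi is x |-> 1 (x) x, and
    the extension of psi to Q (x) ZT(pi) is inverse to phi.

    For the integral forms the point is that ZT(pi) is generated by the divided
    powers alone ([ZTalg_ind]).  Consider the functions g on weights such
    that some element x of the subring they generate satisfies
    x 1_l = g(l) 1_l for all l.  They form a ring.  In Kostant's formula for
    a = b ([T_kostant]), the term t = a shows by induction on a that this ring
    contains l |-> binom(<alpha_i^vee, l>, a), and Pascal's rule allows an
    integer shift of the argument ([diag_binz]).  Squares of such binomials
    separate any two weights, and a product of them is 1 at l and 0 on the
    rest of W pi,
    so 1_l lies in the subring ([T_gen_one]).  Hence psi maps ZT(pi) into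
    ZS(pi), and phi, which sends e^a/a! to e^(a), maps ZS(pi) onto ZT(pi). *)

Set Implicit Arguments.
Unset Strict Implicit.
Unset Printing Implicit Defensive.

Import Order.TTheory GRing.Theory Num.Theory.

Local Open Scope classical_set_scope.
Local Open Scope ring_scope.

(** * Homomorphisms out of a presented algebra *)

Section FreeEval.
Variables (K : comNzRingType) (G : choiceType) (R : pzRingType).
Variables (iota : {rmorphism K -> R}) (h : G -> R).
Hypothesis iota_central : forall c x, GRing.comm (iota c) x.
Local Notation F := (freealg K G).

Let mval (k : {fmonom G}) : R := \prod_(g <- fmonom_val k) h g.

(** The target is a ring that receives K centrally through [iota], and may be
    trivial: this covers at once Q-algebras, for K = Q, and plain rings, for
    K = Z. *)
Definition freeeval (x : F) : R :=
  \sum_(k <- msupp x) iota (mcoeff k x) * mval k.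

Let freeevalw (d : {fset {fmonom G}}) x : fsubset (msupp x) d ->
  freeeval x = \sum_(k <- d) iota (mcoeff k x) * mval k.
Proof.
move=> le; rewrite [LHS](big_fset_incl _ le) => //= k _ /mcoeff_outdom ->.
by rewrite rmorph0 mul0r.
Qed.

Lemma freeeval_is_zmod_morphism : zmod_morphism freeeval.
Proof.
move=> x y; pose d := fsetU (msupp x) (msupp y).
rewrite (@freeevalw d) ?msuppB_le // (@freeevalw d x) ?fsubsetUl //.
rewrite (@freeevalw d y) ?fsubsetUr // -sumrB; apply: eq_bigr => k _.
by rewrite mcoeffB rmorphB mulrBl.
Qed.
HB.instance Definition _ :=
  GRing.isZmodMorphism.Build F R freeeval freeeval_is_zmod_morphism.

Let freeevalU c k : freeeval (mkmalgU k c) = iota c * mval k.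
Proof. by rewrite (freeevalw msuppU_le) big_seq_fset1 mcoeffUU. Qed.

Lemma freeeval_is_monoid_morphism : monoid_morphism freeeval.
Proof.
split=> [|x y]; first by rewrite freeevalU rmorph1 mul1r /mval fm1 big_nil.
rewrite malgME raddf_sum /= /(freeeval x) mulr_suml; apply: eq_bigr => k _.
rewrite raddf_sum /= /(freeeval y) mulr_sumr; apply: eq_bigr => l _.
rewrite freeevalU rmorphM -!mulrA; congr (_ * _).
by rewrite /mval fmM big_cat /= !mulrA (iota_central _ (\prod_(_ <- _) _)).
Qed.
HB.instance Definition _ :=
  GRing.isMonoidMorphism.Build F R freeeval freeeval_is_monoid_morphism.

(** The morphism structure depends on [iota_central], which unification cannot
    find, so it is packed here; likewise [preslift_rmorphism]. *)
Definition freeeval_rmorphism : {rmorphism F -> R} := freeeval.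

Lemma freeeval_gen g : freeeval (freegen K g) = h g.
Proof. by rewrite freeevalU rmorph1 mul1r /mval fmU big_seq1. Qed.

Lemma freeevalZ c x : freeeval (c *: x) = iota c * freeeval x.
Proof.
rewrite (freeevalw (msuppZ_le _ _)) mulr_sumr; apply: eq_bigr => k _.
by rewrite mcoeffZ rmorphM mulrA.
Qed.

Variable rel : F -> F -> Prop.
Hypothesis rel_eval : forall x y, rel x y -> freeeval x = freeeval y.

Let freeeval_ker x : ideal_gen rel x -> freeeval x = 0.
Proof.
elim=> {x} [x y /rel_eval xy||x y _ x0 _ y0|a x _ x0|a x _ x0].
- by rewrite raddfB /= xy subrr.
- exact: raddf0.
- by rewrite raddfB /= x0 y0 subr0.
- by rewrite rmorphM /= x0 mulr0.
- by rewrite rmorphM /= x0 mul0r.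
Qed.

Definition preslift (x : presalg rel) : R := freeeval (repr x).

Lemma prespiK x : preslift (prespi rel x) = freeeval x.
Proof.
apply/eqP; rewrite -subr_eq0 -raddfB; apply/eqP/freeeval_ker.
by apply/asboolP/prespiP; rewrite prespi_reprK.
Qed.

Lemma preslift_is_zmod_morphism : zmod_morphism preslift.
Proof.
move=> x y; rewrite -[x]prespi_reprK -[y]prespi_reprK -raddfB.
by rewrite !prespiK raddfB.
Qed.
HB.instance Definition _ :=
  GRing.isZmodMorphism.Build (presalg rel) R preslift preslift_is_zmod_morphism.

Lemma preslift_is_monoid_morphism : monoid_morphism preslift.
Proof.
split=> [|x y]; first by rewrite -(rmorph1 (prespi rel)) prespiK rmorph1.
rewrite -[x]prespi_reprK -[y]prespi_reprK -rmorphM.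
by rewrite !prespiK rmorphM.
Qed.
HB.instance Definition _ :=
  GRing.isMonoidMorphism.Build (presalg rel) R preslift
    preslift_is_monoid_morphism.

Definition preslift_rmorphism : {rmorphism presalg rel -> R} := preslift.

Lemma presliftZ c x : preslift (c *: x) = iota c * preslift x.
Proof. by rewrite -[x]prespi_reprK -linearZ !prespiK freeevalZ. Qed.

End FreeEval.

Lemma presalg_ind (K : comNzRingType) (G : choiceType)
    (rel : freealg K G -> freealg K G -> Prop) (P : presalg rel -> Prop) :
    (forall g, P (prespi rel (freegen K g))) -> P 1 ->
    (forall x y, P x -> P y -> P (x - y)) ->
    (forall x y, P x -> P y -> P (x * y)) ->
    (forall c x, P x -> P (c *: x)) ->
  forall x, P x.
Proof.
move=> Pg P1 PB PM PZ x.
have P0 : P 0 by rewrite -(subrr 1); apply: PB.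
have PD y z : P y -> P z -> P (y + z).
  by move=> Py Pz; rewrite -[z]opprK -[- z]sub0r; apply/PB/PB.
rewrite -[x]prespi_reprK [repr x]monalgE raddf_sum /=.
apply: (big_ind P) => // k _; move: (mcoeff _ _) => c.
have -> : mkmalgU k c = c *: mkmalgU k 1 :> freealg K G.
  by apply/malgP => l; rewrite mcoeffZ !mcoeffU mulrnAr mulr1.
rewrite linearZ; apply: PZ.
case: k => s; elim: s => [|g s IHs].
  by rewrite -fmoneE (_ : mkmalgU _ _ = 1) // rmorph1.
have -> : FMonom (g :: s) = mmul (fmu g) (FMonom s).
  by apply: val_inj; rewrite /= fmM fmU.
have -> : mkmalgU (mmul (fmu g) (FMonom s)) 1 =
    freegen K g * mkmalgU (FMonom s) 1 :> freealg K G.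
  by rewrite malgM_def fgmulUU mulr1.
rewrite rmorphM; exact: (PM _ _ (Pg g) IHs).
Qed.

(** A subring is closed under multiplication by integer scalars. *)
Lemma presalg_int_ind (G : choiceType)
    (rel : freealg int G -> freealg int G -> Prop) (P : presalg rel -> Prop) :
    (forall g, P (prespi rel (freegen int g))) -> P 1 ->
    (forall x y, P x -> P y -> P (x - y)) ->
    (forall x y, P x -> P y -> P (x * y)) ->
  forall x, P x.
Proof.
move=> Pg P1 PB PM; apply: presalg_ind => // c x Px.
have P0 : P 0 by rewrite -(subrr 1); apply: PB.
have PN y : P y -> P (- y) by move=> Py; rewrite -sub0r; apply: PB.
have PMn y m : P y -> P (y *+ m).
  move=> Py; elim: m => [|m IHm]; rewrite ?mulr0n // mulrS -[y in y + _]opprK.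
  by rewrite addrC; apply/PB/PN.
rewrite -[c]intz scaler_int; case: c => c; first by rewrite -pmulrn; apply: PMn.
by rewrite NegzE mulrNz -pmulrn; apply/PN/PMn.
Qed.

(** * Binomial coefficients of an integer *)

Section Binz.
Implicit Types (a : int) (t : nat).

Let ff a t : int := \prod_(0 <= k < t) (a - k%:Z).

Let ffSr a t : ff a t.+1 = ff a t * (a - t%:Z).
Proof. by rewrite /ff big_nat_recr. Qed.

Let ffSl a t : ff (a + 1) t.+1 = (a + 1) * ff a t.
Proof.
rewrite /ff big_nat_recl // subr0; congr (_ * _); apply: eq_bigr => k _.
by rewrite intS; ring.
Qed.

Let ff_diff a t : ff (a + 1) t.+1 = ff a t.+1 + t.+1%:Z * ff a t.
Proof. by rewrite ffSl ffSr intS; ring. Qed.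

(** The division in [binz] is exact: by Pascal's rule for falling factorials,
    the divisibility for t + 1 is invariant under a shift of [a] by 1, and it
    is clear for a = 0. *)
Lemma binzE a t : binz a t * t`!%:Z = \prod_(0 <= k < t) (a - k%:Z).
Proof.
apply: divzK; elim: t a => [|t IHt] a; first by rewrite fact0 dvd1z.
have dvdM b : ((t.+1)`!%:Z %| t.+1%:Z * ff b t)%Z.
  by rewrite factS PoszM; exact: dvdz_mul (dvdzz _) (IHt b).
have IHff b : ((t.+1)`!%:Z %| ff (b + 1) t.+1)%Z = ((t.+1)`!%:Z %| ff b t.+1)%Z.
  by rewrite ff_diff rpredDr.
elim/int_ind: a => [|n IHn|n IHn].
- by rewrite big_nat_recl // subr0 mul0r dvdz0.
- by rewrite intS addrC IHff.
have := IHff (- n.+1%:Z); rewrite -addn1 PoszD opprD subrK => <-; exact: IHn.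
Qed.

Let fact_neq0 t : t`!%:Z != 0.
Proof. by rewrite eqz_nat -lt0n fact_gt0. Qed.

Lemma binz0 a : binz a 0 = 1.
Proof. by apply: (mulIf (fact_neq0 0)); rewrite binzE big_geq. Qed.

Lemma binzS a t : binz (a + 1) t.+1 = binz a t.+1 + binz a t.
Proof.
apply: (mulIf (fact_neq0 t.+1)); rewrite mulrDl !binzE -!/(ff _ _) ff_diff.
by rewrite factS PoszM mulrCA binzE.
Qed.

Lemma mul_binz a t : t.+1%:Z * binz a t.+1 = (a - t%:Z) * binz a t.
Proof.
apply: (mulIf (fact_neq0 t)); rewrite -[RHS]mulrA binzE -/(ff _ _) mulrC mulrA.
by rewrite [RHS]mulrC -ffSr -[RHS]binzE factS PoszM; ring.
Qed.

Lemma binz_small n t : (n < t)%N -> binz n%:Z t = 0.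
Proof.
move=> lt_nt; apply: (mulIf (fact_neq0 t)); rewrite binzE mul0r.
rewrite (big_cat_nat (leq0n n.+1) lt_nt) //= big_nat_recr //= subrr.
by rewrite mulr0 mul0r.
Qed.

Lemma binznn n : binz n%:Z n = 1.
Proof.
elim: n => [|n IHn]; first by rewrite binz0.
by rewrite intS addrC binzS IHn binz_small ?ltnSn // add0r.
Qed.

Lemma binzN1 t : binz (-1) t = (-1) ^+ t.
Proof.
elim: t => [|t IHt]; first by rewrite binz0.
have := binzS (-1) t; rewrite addNr binz_small // IHt exprS mulN1r.
by move/esym/eqP; rewrite addr_eq0 => /eqP.
Qed.

(** If x > y, binom(X - y, x - y) is 1 at x and 0 at y.  If x < y,
    binom(X - x - 1, y - x) vanishes at y and is binom(-1, y - x) = +-1 at x;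
    squaring removes the sign. *)
Lemma binz_separate (x y : int) :
  x != y -> exists c t, binz (x + c) t ^+ 2 = 1 /\ binz (y + c) t = 0.
Proof.
case: (ltgtP x y) => // lt_xy _.
  exists (- x - 1), `|(y - x)%R|%N; rewrite addrA subrr sub0r binzN1.
  split; first by rewrite -exprM mulnC exprM sqrrN expr1n.
  have -> : y + (- x - 1) = (`|(y - x)%R|%N.-1)%:Z by lia.
  by apply: binz_small; lia.
exists (- y), `|(x - y)%R|%N; rewrite subrr; split.
  have -> : x - y = `|(x - y)%R|%N%:Z by lia.
  by rewrite absz_nat binznn expr1n.
by apply: (@binz_small 0); lia.
Qed.

End Binz.

(** * Kostant's formula *)

(** [E] and [F] are the divided powers of [x] and [y]; without torsion, their
    product formulas with [x] and [y] determine them.  The relations are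
    symmetric under exchanging [x] with [y] and [h] with [- h], so the formula
    may be used both ways. *)
Section Sl2.
Variables (R : pzRingType) (x y h : R) (E F : nat -> R).
Hypothesis R_tf : forall n, injective (fun z : R => z *+ n.+1).
Hypotheses (E0 : E 0 = 1) (F0 : F 0 = 1).
Hypothesis xE : forall a, x * E a = E a.+1 *+ a.+1.
Hypothesis Fy : forall b, F b * y = F b.+1 *+ b.+1.
Hypothesis xy : x * y = y * x + h.
Hypothesis hx : h * x = x * h + x *+ 2.
Hypothesis hy : h * y = y * h - y *+ 2.

Let h_E (c : int) a v :
  h * v = v *~ c -> h * (E a * v) = E a * v *~ (c + a%:Z *+ 2).
Proof.
move=> hv; elim: a => [|a IHa]; first by rewrite E0 mul1r addr0.
apply: (@R_tf a) => /=.
rewrite [RHS]pmulrn mulrzAC -pmulrn -mulrnAr -mulrnAl -xE -!mulrA.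
rewrite mulrA hx mulrDl -mulrA IHa mulrnAl [X in _ + X]pmulrn mulrzAr -!mulrzDr.
by congr (_ *~ _); rewrite intS; ring.
Qed.

Let xF (c : int) b w : h * w = w *~ c ->
  x * (F b.+1 * w) = F b.+1 * (x * w) + F b * w *~ (c - b%:Z).
Proof.
elim: b c w => [|b IHb] c w hw.
  have -> : F 1 = y by have := Fy 0; rewrite F0 mul1r.
  by rewrite F0 mul1r subr0 mulrA xy mulrDl hw mulrA.
have hyw : h * (y * w) = y * w *~ (c - 2).
  by rewrite mulrA hy mulrBl -mulrA hw mulrnAl pmulrn mulrzAr -mulrzBr.
apply: (@R_tf b.+1) => /=.
rewrite [RHS]mulrnDl [X in _ = _ + X]pmulrn mulrzAC -pmulrn.
rewrite -mulrnAr -!mulrnAl -!Fy -!mulrA (IHb _ _ hyw).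
rewrite [x * (y * w)]mulrA xy mulrDl hw mulrDr -!addrA; congr (_ + _).
  by rewrite -[y * x * w]mulrA.
rewrite [F b * (y * w)]mulrA Fy !mulrnAl !pmulrn mulrzAr -!mulrzA -mulrzDr.
by congr (_ *~ _); rewrite !intS; ring.
Qed.

(* Divided powers of exponent a - t and b - t, equal to 0 for a negative
   exponent: with them the sums may run over any range that is long enough. *)
Let EE a t := if (t <= a)%N then E (a - t) else 0.
Let FF b t := if (t <= b)%N then F (b - t) else 0.

Let h_EE (c : int) a t v :
  h * v = v *~ c -> h * (EE a t * v) = EE a t * v *~ (c + (a%:Z - t%:Z) *+ 2).
Proof.
rewrite /EE; case: leqP => [le_ta /(h_E (a - t)) ->|_ _]; last first.
  by rewrite mul0r mulr0 mul0rz.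
by rewrite subzn.
Qed.

Let xFF (c : int) b t w : h * w = w *~ c -> x * (FF b t * w) =
  FF b t * (x * w) + FF b t.+1 * w *~ (c - (b%:Z - t%:Z) + 1).
Proof.
move=> hw; rewrite /FF; case: (ltngtP t b) => [lt_tb|_|->]; last 1 first.
- by rewrite subnn F0 !mul1r mul0r mul0rz addr0.
- rewrite -(subnSK lt_tb) (xF _ hw); congr (_ + _ *~ _).
  by rewrite -subzn // intS; ring.
by rewrite !mul0r mul0rz mulr0 addr0.
Qed.

Let xEE a t : x * EE a t = EE a.+1 t *~ (a.+1%:Z - t%:Z).
Proof.
rewrite /EE; case: (ltngtP t a.+1) => [lt_ta|lt_at|->].
- by rewrite -ltnS lt_ta xE subSn // subzn ?(ltnW lt_ta) // subSn // -pmulrn.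
- by rewrite leqNgt (ltnW lt_at) mulr0 mul0rz.
by rewrite ltnn subrr mulr0z mulr0.
Qed.

Let kostant_full (c : int) a b v : h * v = v *~ c ->
  E a * (F b * v) =
  \sum_(t < a.+1) FF b t * (EE a t * v) *~ binz (a%:Z - b%:Z + c) t.
Proof.
move=> hv; elim: a => [|a IHa].
  by rewrite big_ord1 binz0 mulr1z /EE /FF !subn0 E0 !mul1r.
apply: (@R_tf a) => /=.
rewrite -mulrnAl -xE -mulrA IHa mulr_sumr.
(* Multiplying the formula for a by x on the left, x is moved past F^(b-t); this
   contributes to the terms of index t and t + 1 of the formula for a + 1. *)
pose T t := FF b t * (EE a.+1 t * v).
pose B t := binz (a%:Z - b%:Z + c) t.
have -> : \sum_(t < a.+1) x * (FF b t * (EE a t * v) *~ B t) =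
    \sum_(t < a.+1) T t *~ ((a.+1%:Z - t%:Z) * B t) +
    \sum_(t < a.+1) T t.+1 *~
      ((c + (a%:Z - t%:Z) *+ 2 - (b%:Z - t%:Z) + 1) * B t).
  rewrite -big_split; apply: eq_bigr => t _ /=.
  rewrite mulrzAr (xFF b t (h_EE a t hv)) [x * (EE a t * v)]mulrA xEE.
  by rewrite mulrzAl mulrzAr mulrzDl !mulrzA.
have -> : \sum_(t < a.+1) T t *~ ((a.+1%:Z - t%:Z) * B t) =
    \sum_(t < a.+2) T t *~ ((a.+1%:Z - t%:Z) * B t).
  by rewrite [RHS]big_ord_recr /= subrr mul0r mulr0z addr0.
rewrite [X in X + _]big_ord_recl [X in _ = X *+ _]big_ord_recl /=.
rewrite [RHS]mulrnDl -sumrMnl -addrA -big_split /=; congr (_ + _).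
  by rewrite subr0 /B !binz0 mulr1 mulr1z pmulrn.
apply: eq_bigr => t _ /=; rewrite -mulrzDr [RHS]pmulrn -mulrzA; congr (_ *~ _).
have -> : a.+1%:Z - b%:Z + c = a%:Z - b%:Z + c + 1 by rewrite intS; ring.
rewrite /bump /= add1n binzS -!/(B _).
have := mul_binz (a%:Z - b%:Z + c) t; rewrite -!/(B _) !intS => eqB.
transitivity ((a%:Z - t%:Z) * B t.+1 + (a%:Z + 1) * B t +
  (a%:Z - b%:Z + c - t%:Z) * B t); first by ring.
by rewrite -eqB; ring.
Qed.

(** By induction on [a], from x F^(b) w = F^(b) x w + (c - b + 1) F^(b-1) w for
    w of weight c; the coefficients obey Pascal's rule and
    t binom(c, t) = (c - t + 1) binom(c, t - 1). *)
Lemma kostant (c : int) a b v : h * v = v *~ c ->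
  E a * F b * v = \sum_(t < (minn a b).+1)
    F (b - t)%N * E (a - t)%N * v *~ binz (a%:Z - b%:Z + c) t.
Proof.
move=> hv; rewrite -mulrA (kostant_full a b hv).
have le_ma : ((minn a b).+1 <= a.+1)%N by rewrite ltnS geq_minl.
rewrite -!(big_mkord xpredT
  (fun t => FF b t * (EE a t * v) *~ binz (a%:Z - b%:Z + c) t)).
rewrite (big_cat_nat _ le_ma) //= [X in _ + X]big_nat_cond.
rewrite [X in _ + X]big1 ?addr0; last first.
  move=> t; rewrite andbT gtn_min => /andP[/orP[lt_at|lt_bt] le_ta].
    by move: le_ta; rewrite ltnS leqNgt lt_at.
  by rewrite /FF leqNgt lt_bt mul0r mul0rz.
rewrite big_mkord; apply: eq_bigr => t _.
have := ltn_ord t; rewrite ltnS leq_min => /andP[le_ta le_tb].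
by rewrite /EE /FF le_ta le_tb mulrA.
Qed.

End Sl2.

(** * The relations of S(pi) and T(pi) in a ring *)

Section Relations.
Variables (n : nat) (A : 'M[int]_n) (pi : set (weight n)).
Local Notation Wpi := (weyl_orbits A pi).
Local Notation alpha := (sroot A).
Variable R : pzRingType.

(** The sum over W pi is a sum over a finite support, and is 0 when infinitely
    many terms are nonzero; in the presentations, whose 1_l are nonzero
    elements of the free algebra, an infinite W pi would thus give 1 = 0. *)
Record one_rels (one : weight n -> R) : Prop := OneRels {
  one_out : forall l, ~ Wpi l -> one l = 0;
  one_mul : forall l m, one l * one m = if l == m then one l else 0;
  one_sum : finite_set Wpi -> \sum_(l \in Wpi) one l = 1;
  one_degenerate : ~ finite_set Wpi -> 1 = 0 :> R }.

(** The relation moving an idempotent past e_i is stated once for all weights,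
    those outside W pi included: this form is equivalent to the two relations
    of the presentation, one for each position of the idempotent. *)
Record S_rels (e f : 'I_n -> R) (one : weight n -> R) : Prop := SRels {
  S_one : one_rels one;
  S_e_one : forall i l, e i * one l = one (l + alpha i) * e i;
  S_f_one : forall i l, f i * one l = one (l - alpha i) * f i;
  S_ef : forall i l, (e i * f i - f i * e i) * one l = one l *~ l 0 i;
  S_ef_neq : forall i j, i != j -> e i * f j = f j * e i;
  S_serre_e : forall i j, i != j -> let m := serre_exp A i j in
    \sum_(s < m.+1)
      e i ^+ (m - s) * e j * e i ^+ s *~ ((-1) ^+ s * 'C(m, s)%:Z) = 0;
  S_serre_f : forall i j, i != j -> let m := serre_exp A i j in
    \sum_(s < m.+1)
      f i ^+ (m - s) * f j * f i ^+ s *~ ((-1) ^+ s * 'C(m, s)%:Z) = 0 }.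

Record T_rels (e f : 'I_n -> nat -> R) (one : weight n -> R) : Prop := TRels {
  T_one : one_rels one;
  T_ee : forall i a b, e i a * e i b = e i (a + b)%N *+ 'C(a + b, a);
  T_ff : forall i a b, f i a * f i b = f i (a + b)%N *+ 'C(a + b, a);
  T_e0 : forall i, e i 0%N = 1;
  T_f0 : forall i, f i 0%N = 1;
  T_ef : forall i j a b, i != j -> e i a * f j b = f j b * e i a;
  T_eonef : forall i a b l, e i a * one (- l) * f i b =
    \sum_(t < (minn a b).+1)
      f i (b - t)%N * one (- l + (a%:Z + b%:Z - t%:Z) *: alpha i)
        * e i (a - t)%N *~ binz (a%:Z + b%:Z - l 0 i) t;
  T_fonee : forall i a b l, f i b * one l * e i a =
    \sum_(t < (minn a b).+1)
      e i (a - t)%N * one (l - (a%:Z + b%:Z - t%:Z) *: alpha i)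
        * f i (b - t)%N *~ binz (a%:Z + b%:Z - l 0 i) t;
  T_e_one : forall i a l, e i a * one l = one (l + a%:Z *: alpha i) * e i a;
  T_f_one : forall i b l, f i b * one l = one (l - b%:Z *: alpha i) * f i b;
  T_serre_e : forall i j, i != j -> let m := serre_exp A i j in
    \sum_(s < m.+1) e i (m - s)%N * e j 1%N * e i s *~ (-1) ^+ s = 0;
  T_serre_f : forall i j, i != j -> let m := serre_exp A i j in
    \sum_(s < m.+1) f i (m - s)%N * f j 1%N * f i s *~ (-1) ^+ s = 0 }.

(** The idempotents decompose 1, so an identity may be checked after
    multiplication by each of them; this avoids all reindexing of sums over
    W pi. *)
Lemma eq_on_weights (one : weight n -> R) (x y : R) :
  one_rels one -> (forall l, Wpi l -> x * one l = y * one l) -> x = y.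
Proof.
case=> _ _ sum1 deg eqxy; rewrite -[x]mulr1 -[y]mulr1.
have [Wfin|/deg ->] := pselect (finite_set Wpi); last by rewrite !mulr0.
rewrite -sum1 // fsbig_finite // !mulr_sumr; apply: eq_big_seq => l.
by rewrite in_fset_set // => /set_mem/eqxy.
Qed.

End Relations.

(** * From the relations of S(pi) to those of T(pi) *)

Section StoT.
Variables (n : nat) (A : 'M[int]_n) (pi : set (weight n)).
Hypothesis A_diag : forall i, A i i = 2.
Variable R : pzRingType.
Hypothesis R_tf : forall m, injective (fun z : R => z *+ m.+1).
Local Notation alpha := (sroot A).

Variables (dp : R -> nat -> R).
Hypothesis dpE : forall z m, dp z m *+ m`! = z ^+ m.

Let tf m (z w : R) : (0 < m)%N -> z *+ m = w *+ m -> z = w.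
Proof. by case: m => // m _; apply: R_tf. Qed.

Let dp0 z : dp z 0 = 1.
Proof. by have := dpE z 0; rewrite expr0. Qed.

Let dp1 z : dp z 1 = z.
Proof. by have := dpE z 1; rewrite expr1. Qed.

Let dpM z a b : dp z a * dp z b = dp z (a + b) *+ 'C(a + b, a).
Proof.
apply: (@tf (a`! * b`!)%N); first by rewrite muln_gt0 !fact_gt0.
rewrite [LHS]mulrnA -mulrnAl dpE -mulrnAr dpE -exprD -mulrnA.
by have := bin_fact (leq_addr b a); rewrite addKn => ->; rewrite dpE.
Qed.

Let dp_l z a : z * dp z a = dp z a.+1 *+ a.+1.
Proof. by have := dpM z 1 a; rewrite dp1 add1n bin1. Qed.

Let dp_r z b : dp z b * z = dp z b.+1 *+ b.+1.
Proof. by have := dpM z b 1; rewrite dp1 addn1 binSn. Qed.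

Let dp_comm z w a b : z * w = w * z -> dp z a * dp w b = dp w b * dp z a.
Proof.
move=> zw; apply: (@tf (a`! * b`!)%N); first by rewrite muln_gt0 !fact_gt0.
rewrite [LHS]mulrnA -mulrnAl dpE -mulrnAr dpE [in RHS]mulnC.
rewrite [RHS]mulrnA -mulrnAl dpE -mulrnAr dpE.
by apply: commrX; apply/commr_sym/commrX/commr_sym.
Qed.

Variables (e f : 'I_n -> R) (one : weight n -> R).
Hypothesis rels : S_rels A pi e f one.
Let ones := S_one rels.

Let dp_one z (c : weight n) m l : (forall l, z * one l = one (l + c) * z) ->
  dp z m * one l = one (l + m%:Z *: c) * dp z m.
Proof.
move=> zc; apply: (@tf m`!); first by rewrite fact_gt0.
rewrite -mulrnAl -mulrnAr dpE.
elim: m l => [|m IHm] l; first by rewrite scale0r addr0 mul1r mulr1.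
rewrite exprSr -mulrA zc mulrA IHm -mulrA -exprSr.
by rewrite intS scalerDl scale1r addrA.
Qed.

Let dp_e_one i a l :
  dp (e i) a * one l = one (l + a%:Z *: alpha i) * dp (e i) a.
Proof. by apply: dp_one => m; apply: S_e_one rels _ _. Qed.

Let dp_f_one i b l :
  dp (f i) b * one l = one (l - b%:Z *: alpha i) * dp (f i) b.
Proof. by rewrite -scalerN; apply: dp_one => m; apply: S_f_one rels _ _. Qed.

(* The image of the coroot alpha_i^vee. *)
Let h i := e i * f i - f i * e i.

Let h_one i l : h i * one l = one l *~ l 0 i.
Proof. exact: S_ef rels _ _. Qed.

Let ef i : e i * f i = f i * e i + h i.
Proof. by rewrite addrC subrK. Qed.

Let he i : h i * e i = e i * h i + e i *+ 2.
Proof.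
apply: (eq_on_weights ones) => l _.
rewrite [RHS]mulrDl -!mulrA h_one (S_e_one rels) mulrA h_one.
by rewrite !mxE A_diag mulrzAr mulrnAl (S_e_one rels) mulrzAl mulrzDr pmulrn.
Qed.

Let hf i : h i * f i = f i * h i - f i *+ 2.
Proof.
apply: (eq_on_weights ones) => l _.
rewrite [RHS]mulrBl -!mulrA h_one (S_f_one rels) mulrA h_one.
by rewrite !mxE A_diag mulrzAr mulrnAl (S_f_one rels) mulrzAl mulrzBr pmulrn.
Qed.

Let eonef i a b (l : weight n) :
  dp (e i) a * one (- l) * dp (f i) b =
  \sum_(t < (minn a b).+1)
    dp (f i) (b - t)%N * one (- l + (a%:Z + b%:Z - t%:Z) *: alpha i)
      * dp (e i) (a - t)%N *~ binz (a%:Z + b%:Z - l 0 i) t.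
Proof.
(* Moving the idempotent to the right of f^(b) turns - l into m, and the claim
   into Kostant's formula for the vector 1_m. *)
set m := - l + b%:Z *: alpha i.
rewrite [- l in LHS](_ : _ = m - b%:Z *: alpha i); last by rewrite addrK.
have hm : h i * one m = one m *~ (- l 0 i + b%:Z *+ 2).
  by rewrite h_one !mxE A_diag mulr_natr.
rewrite -mulrA -dp_f_one mulrA.
rewrite (kostant R_tf (dp0 _) (dp0 _) (dp_l _) (dp_r _) (ef i) (he i) (hf i)
  _ _ hm).
apply: eq_bigr => t _; have := ltn_ord t; rewrite ltnS leq_min => /andP[ta tb].
rewrite -mulrA dp_e_one mulrA; congr (_ * one _ * _ *~ binz _ _); last by ring.
by rewrite -addrA -scalerDl -subzn // [b%:Z + _]addrC [in RHS]addrAC.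
Qed.

Let fonee i a b (l : weight n) :
  dp (f i) b * one l * dp (e i) a =
  \sum_(t < (minn a b).+1)
    dp (e i) (a - t)%N * one (l - (a%:Z + b%:Z - t%:Z) *: alpha i)
      * dp (f i) (b - t)%N *~ binz (a%:Z + b%:Z - l 0 i) t.
Proof.
(* As before, with the sl2 triple (f, e, - h). *)
set m := l - a%:Z *: alpha i.
rewrite [l in LHS](_ : _ = m + a%:Z *: alpha i); last by rewrite subrK.
have hm : - h i * one m = one m *~ (- l 0 i + a%:Z *+ 2).
  by rewrite mulNr h_one !mxE A_diag mulr_natr -mulrNz opprB addrC.
have fe : f i * e i = e i * f i + - h i by rewrite ef addrK.
have hf' : - h i * f i = f i * - h i + f i *+ 2.
  by rewrite mulNr hf opprB mulrN addrC.
have he' : - h i * e i = e i * - h i - e i *+ 2.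
  by rewrite mulNr he opprD mulrN.
rewrite -mulrA -dp_e_one mulrA.
rewrite (kostant R_tf (dp0 _) (dp0 _) (dp_l _) (dp_r _) fe hf' he' _ _ hm).
rewrite minnC.
apply: eq_bigr => t _; have := ltn_ord t; rewrite ltnS leq_min => /andP[ta tb].
rewrite -mulrA dp_f_one mulrA; congr (_ * one _ * _ *~ binz _ _).
  rewrite -addrA -opprD -scalerDl -subzn // [in RHS]addrAC.
  by congr (l - _ *: _); ring.
by ring.
Qed.

Let dp_serre z w m :
    \sum_(s < m.+1)
      z ^+ (m - s) * w * z ^+ s *~ ((-1) ^+ s * 'C(m, s)%:Z) = 0 ->
  \sum_(s < m.+1) dp z (m - s)%N * dp w 1 * dp z s *~ (-1) ^+ s = 0.
Proof.
move=> serre; apply: (@tf m`!); first by rewrite fact_gt0.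
rewrite mul0rn -sumrMnl -[RHS]serre; apply: eq_bigr => s _.
have le_sm : (s <= m)%N by rewrite -ltnS.
rewrite dp1 [LHS]pmulrn mulrzAC [_ ^+ s * _%:Z in RHS]mulrC.
rewrite [RHS]mulrzA -!pmulrn.
congr (_ *~ _); rewrite -(bin_fact le_sm) mulnC mulrnA; congr (_ *+ _).
by rewrite mulrnA -mulrnAr dpE -!mulrnAl dpE.
Qed.

(** The relations of T(pi) around an idempotent are Kostant's formula; the
    others are those of S(pi) divided by factorials. *)
Lemma S_rels_T_rels : T_rels A pi (fun i => dp (e i)) (fun i => dp (f i)) one.
Proof.
split=> //.
- by move=> i j a b ij; apply/dp_comm/(S_ef_neq rels).
- by move=> i j ij m; apply/dp_serre/(S_serre_e rels).
- by move=> i j ij m; apply/dp_serre/(S_serre_f rels).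
Qed.

End StoT.

(** * From the relations of T(pi) to those of S(pi) *)

Lemma divided_powE (R : pzRingType) (z : nat -> R) m :
    (forall a b, z a * z b = z (a + b)%N *+ 'C(a + b, a)) -> z 0%N = 1 ->
  z 1%N ^+ m = z m *+ m`!.
Proof.
move=> zM z0; elim: m => [|m IHm]; first by rewrite expr0 z0.
by rewrite exprS IHm mulrnAr zM add1n bin1 -mulrnA factS.
Qed.

Section TtoS.
Variables (n : nat) (A : 'M[int]_n) (pi : set (weight n)).
Hypothesis A_diag : forall i, A i i = 2.
Variable R : pzRingType.
Local Notation Wpi := (weyl_orbits A pi).
Local Notation alpha := (sroot A).
Variables (e f : 'I_n -> nat -> R) (one : weight n -> R).
Hypothesis rels : T_rels A pi e f one.
Let ones := T_one rels.

(** With the idempotent on the right, the binomial coefficient involves its own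
    weight, and for a = b the term t = a of the formula is a scalar multiple
    of 1_l. *)
Lemma T_kostant i a b l : e i a * f i b * one l =
  \sum_(t < (minn a b).+1)
    f i (b - t)%N * e i (a - t)%N * one l *~ binz (a%:Z - b%:Z + l 0 i) t.
Proof.
rewrite -mulrA (T_f_one rels) mulrA -[l - _]opprK (T_eonef rels).
apply: eq_bigr => t _; have := ltn_ord t; rewrite ltnS leq_min => /andP[ta tb].
rewrite -[in RHS]mulrA (T_e_one rels) mulrA.
congr (_ * one _ * _ *~ binz _ _); last by rewrite !mxE A_diag; ring.
rewrite opprK -addrA -scaleNr -scalerDl -subzn //.
by congr (_ + _ *: _); ring.
Qed.

Let pow_serre (z : nat -> R) w m :
    (forall a b, z a * z b = z (a + b)%N *+ 'C(a + b, a)) -> z 0%N = 1 ->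
    \sum_(s < m.+1) z (m - s)%N * w * z s *~ (-1) ^+ s = 0 ->
  \sum_(s < m.+1)
    z 1%N ^+ (m - s) * w * z 1%N ^+ s *~ ((-1) ^+ s * 'C(m, s)%:Z) = 0.
Proof.
move=> zM z0 /(congr1 (fun u => u *+ m`!)); rewrite mul0rn -sumrMnl => sum0.
rewrite -[RHS]sum0; apply: eq_bigr => s _.
have le_sm : (s <= m)%N by rewrite -ltnS.
rewrite [RHS]pmulrn [RHS]mulrzAC [_ ^+ s * _%:Z in LHS]mulrC.
rewrite [LHS]mulrzA -!pmulrn.
congr (_ *~ _); rewrite -(bin_fact le_sm) mulnC mulrnA; congr (_ *+ _).
by rewrite mulrnA !divided_powE // !mulrnAl mulrnAr mulrnAC.
Qed.

(** The relation for e_i f_i - f_i e_i is Kostant's formula for a = b = 1, and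
    the Serre relations are multiplied by a factorial. *)
Lemma T_rels_S_rels : S_rels A pi (fun i => e i 1%N) (fun i => f i 1%N) one.
Proof.
split=> //.
- by move=> i l; rewrite (T_e_one rels) scale1r.
- by move=> i l; rewrite (T_f_one rels) scale1r.
- move=> i l; rewrite mulrBl T_kostant big_ord_recl big_ord1 /= binz0 mulr1z.
  rewrite addrAC subrr add0r subrr add0r (T_e0 rels) (T_f0 rels) !mul1r.
  by have := mul_binz (l 0 i) 0; rewrite mul1r binz0 subr0 mulr1 => ->.
- by move=> i j; apply: T_ef rels _ _ _ _.
- by move=> i j ij m; apply/pow_serre/(T_serre_e rels ij);
    [apply: T_ee rels _ | apply: T_e0 rels _].
by move=> i j ij m; apply/pow_serre/(T_serre_f rels ij);
  [apply: T_ff rels _ | apply: T_f0 rels _].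
Qed.

(** * Generation by divided powers *)

(** [P] stands for membership in a subring that contains the divided powers. *)
Section Generation.
Variable P : R -> Prop.
Hypotheses (P1 : P 1) (PB : forall x y, P x -> P y -> P (x - y)).
Hypothesis PM : forall x y, P x -> P y -> P (x * y).
Hypotheses (Pe : forall i a, P (e i a)) (Pf : forall i b, P (f i b)).

Let P0 : P 0.
Proof. by rewrite -(subrr 1); apply: PB. Qed.

Let PD x y : P x -> P y -> P (x + y).
Proof. by move=> Px Py; rewrite -[y]opprK -[- y]sub0r; apply/PB/PB. Qed.

Definition eigenvalue_fun (g : weight n -> int) : Prop :=
  exists2 x, P x & forall l, x * one l = one l *~ g l.

Let eq_diag g g' : g =1 g' -> eigenvalue_fun g -> eigenvalue_fun g'.
Proof. by move=> eqg [x Px xg]; exists x => // l; rewrite xg eqg. Qed.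

Let diag1 : eigenvalue_fun (fun=> 1).
Proof. by exists 1 => // l; rewrite mul1r. Qed.

Let diagB g g' : eigenvalue_fun g -> eigenvalue_fun g' ->
  eigenvalue_fun (fun l => g l - g' l).
Proof.
move=> [x Px xg] [y Py yg]; exists (x - y); first exact: PB.
by move=> l; rewrite mulrBl xg yg mulrzBr.
Qed.

Let diagD g g' : eigenvalue_fun g -> eigenvalue_fun g' ->
  eigenvalue_fun (fun l => g l + g' l).
Proof.
move=> [x Px xg] [y Py yg]; exists (x + y); first exact: PD.
by move=> l; rewrite mulrDl xg yg mulrzDr.
Qed.

Let diagM g g' : eigenvalue_fun g -> eigenvalue_fun g' ->
  eigenvalue_fun (fun l => g l * g' l).
Proof.
move=> [x Px xg] [y Py yg]; exists (x * y); first exact: PM.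
by move=> l; rewrite -mulrA yg mulrzAr xg mulrzA.
Qed.

(** In e^(a) f^(a) 1_l the term t = a of Kostant's formula is
    binom(l_i, a) 1_l, and the others are f^(a-t) e^(a-t) 1_l times
    binom(l_i, t) for t < a, covered by the induction hypothesis. *)
Lemma diag_binz0 i a : eigenvalue_fun (fun l => binz (l 0 i) a).
Proof.
elim/ltn_ind: a => a IHa.
have lower k : (k <= a)%N -> exists2 u, P u & forall l, u * one l =
    \sum_(t < k) f i (a - t)%N * e i (a - t)%N * one l *~ binz (l 0 i) t.
  elim: k => [_|k IHk lt_ka].
    by exists 0 => // l; rewrite mul0r big_ord0.
  have [u Pu ug] := IHk (ltnW lt_ka); have [x Px xg] := IHa k lt_ka.
  exists (u + f i (a - k)%N * e i (a - k)%N * x).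
    by apply: PD => //; do !apply: PM.
  by move=> l; rewrite mulrDl ug -mulrA xg mulrzAr big_ord_recr.
have [u Pu ug] := lower a (leqnn a).
exists (e i a * f i a - u); first by apply/PB/Pu/PM.
move=> l; rewrite mulrBl ug T_kostant minnn big_ord_recr /= subrr add0r.
by rewrite addrAC subrr add0r subnn (T_e0 rels) (T_f0 rels) !mul1r.
Qed.

(** Pascal's rule shifts the argument by 1, upwards and downwards. *)
Lemma diag_binz i c a : eigenvalue_fun (fun l => binz (l 0 i + c) a).
Proof.
elim: a c => [|a IHa] c; first by apply: eq_diag diag1 => l; rewrite binz0.
elim/int_ind: c => [|k IHk|k IHk].
- by apply: eq_diag (diag_binz0 i a.+1) => l; rewrite addr0.
- apply: eq_diag (diagD IHk (IHa k)) => l.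
  by rewrite -binzS -addrA [_ + 1]addrC -intS.
apply: eq_diag (diagB IHk (IHa (- k.+1%:Z))) => l.
have -> : l 0 i - k%:Z = l 0 i - k.+1%:Z + 1 by rewrite intS; ring.
by rewrite binzS addrK.
Qed.

Let diag_separate l m :
  l != m -> exists2 g, eigenvalue_fun g & g l = 1 /\ g m = 0.
Proof.
move=> lm; have [i li] : exists i, l 0 i != m 0 i.
  apply/existsP; apply: contraR lm; rewrite negb_exists => /forallP eqlm.
  by apply/eqP/rowP => i; apply/eqP; have := eqlm i; rewrite negbK.
have [c [t [gl gm]]] := binz_separate li.
exists (fun l => binz (l 0 i + c) t * binz (l 0 i + c) t).
  by apply: diagM; apply: diag_binz.
by rewrite -expr2 gl gm mulr0.
Qed.

Let diag_delta l (s : seq (weight n)) :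
  exists2 g, eigenvalue_fun g & g l = 1 /\ {in s, forall m, m != l -> g m = 0}.
Proof.
elim: s => [|m s [g dg [gl g0]]]; first by exists (fun=> 1).
have [->|lm] := eqVneq m l.
  exists g => //; split=> // k; rewrite inE => /orP[/eqP-> /eqP //|].
  exact: g0.
rewrite eq_sym in lm; have [g' dg' [g'l g'm]] := diag_separate lm.
exists (fun k => g k * g' k); first exact: diagM.
split=> [|k]; first by rewrite gl g'l.
by rewrite inE => /orP[/eqP-> _|ks kl]; rewrite ?g'm ?mulr0 // g0 ?mul0r.
Qed.

(** A product of functions separating l from each other weight of W pi takes the
    value 1 at l and 0 elsewhere on W pi; an element with these eigenvalues is
    1_l. *)
Lemma T_gen_one l : P (one l).
Proof.
have [Wfin|/(one_degenerate ones) one0] := pselect (finite_set Wpi); last first.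
  by rewrite -[one l]mulr1 one0 mulr0.
have [g [x Px xg] [gl g0]] := diag_delta l (fset_set Wpi).
suff <- : x = one l by [].
apply: (eq_on_weights ones) => m Wm; rewrite xg (one_mul ones).
have [<-|ml] := eqVneq l m; first by rewrite gl.
by rewrite g0 ?mulr0z 1?eq_sym // in_fset_set ?mem_set.
Qed.

End Generation.
End TtoS.

(** * The presentations and the relations *)

(** Rules that compute the value of a ring morphism [p] on an expression of the
    free algebra; they are combined as terms, one for each relation. *)
Section Rules.
Variables (K : comNzRingType) (G : choiceType) (R : pzRingType).
Variable p : {rmorphism freealg K G -> R}.
Implicit Types (x y : freealg K G) (a b : R).

Lemma evalM x y a b : p x = a -> p y = b -> p (x * y) = a * b.
Proof. by move=> <- <-; rewrite rmorphM. Qed.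

Lemma evalB x y a b : p x = a -> p y = b -> p (x - y) = a - b.
Proof. by move=> <- <-; rewrite raddfB. Qed.

Lemma evalX x k a : p x = a -> p (x ^+ k) = a ^+ k.
Proof. by move=> <-; rewrite rmorphXn. Qed.

Lemma evalZ (c : K) (m : int) x a :
  p x = a -> c = m%:~R -> p (c *: x) = a *~ m.
Proof.
move=> <- ->; rewrite scaler_int.
by case: m => m; rewrite ?NegzE ?mulrNz -!pmulrn ?raddfN /= raddfMn.
Qed.

Lemma eval_sum m (F : 'I_m -> freealg K G) (g : 'I_m -> R) :
  (forall s, p (F s) = g s) -> p (\sum_(s < m) F s) = \sum_(s < m) g s.
Proof. by move=> Fg; rewrite raddf_sum; apply: eq_bigr => s _; exact: Fg. Qed.

Variables (I : choiceType) (W : set I) (v : I -> freealg K G).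

Lemma eval_fsum : finite_set W ->
  p (\sum_(l \in W) v l) = \sum_(l \in W) p (v l).
Proof. by move=> Wfin; rewrite !fsbig_finite // raddf_sum. Qed.

Lemma eval_fsum_infinite :
  ~ finite_set W -> (forall l, W l -> v l != 0) -> p (\sum_(l \in W) v l) = 0.
Proof.
move=> Winf v0; rewrite fsbig_dflt ?raddf0 //; apply: sub_infinite_set Winf.
by move=> l Wl; split=> //=; apply/eqP/v0.
Qed.

Lemma eval_diag (c : I -> int) m : finite_set W -> W m ->
    (forall l, p (v l) * p (v m) = if l == m then p (v l) else 0) ->
  p (\sum_(l \in W) (c l)%:~R *: v l) * p (v m) = p (v m) *~ c m.
Proof.
move=> Wfin Wm v_mul; rewrite fsbig_finite //= raddf_sum mulr_suml /=.
rewrite (big_fsetD1 m) ?in_fset_set ?mem_set //= big1_fset ?addr0 => [|l].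
  by rewrite (evalZ erefl erefl) mulrzAl v_mul eqxx.
rewrite in_fsetD1 => /andP[ml _] _.
by rewrite (evalZ erefl erefl) mulrzAl v_mul (negbTE ml) mul0rz.
Qed.

End Rules.

Section EvalS.
Variables (n : nat) (A : 'M[int]_n) (pi : set (weight n)).
Local Notation Wpi := (weyl_orbits A pi).
Variables (R : pzRingType) (p : {rmorphism freealg rat (Sgen A pi) -> R}).
Local Notation e := (fun i => p (Sfree_e A pi i)).
Local Notation f := (fun i => p (Sfree_f A pi i)).
Local Notation one := (fun l => p (Sfree_one A pi l)).

Let one_neq0 l : Wpi l -> Sfree_one A pi l != 0.
Proof.
move=> Wl; rewrite /Sfree_one; case: insubP => [u _ _|].
  by rewrite monalgU_eq0 oner_eq0.
by rewrite mem_set.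
Qed.

Let one_out0 l : ~ Wpi l -> Sfree_one A pi l = 0.
Proof.
rewrite /Sfree_one; case: insubP => //= u Wl _ /=; case.
exact: set_mem Wl.
Qed.

(* The Serre coefficients of the presentation are integers seen in Q. *)
Let coef_rat (s m : nat) :
  (-1) ^+ s * 'C(m, s)%:R = ((-1) ^+ s * 'C(m, s)%:Z)%:~R :> rat.
Proof. by rewrite rmorphM rmorphXn rmorphN1. Qed.

Section Respects.
Hypothesis p_rel : forall x y, Srel A pi x y -> p x = p y.

Let rel x y a b : Srel A pi x y -> p x = a -> p y = b -> a = b.
Proof. by move=> /p_rel xy <- <-. Qed.

Let S_ones : one_rels A pi one.
Proof.
split=> [l Wl|l m|Wfin|Winf].
- by rewrite one_out0 // raddf0.
- have [Wl|Wl] := pselect (Wpi l); last first.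
    by rewrite one_out0 // raddf0 mul0r if_same.
  have [Wm|Wm] := pselect (Wpi m); last first.
    by rewrite (one_out0 Wm) raddf0 mulr0; case: eqP => // lm; rewrite lm in Wl.
  have := p_rel (Srel_idem Wl Wm); rewrite (evalM erefl erefl) => ->.
  by case: eqP; rewrite ?raddf0.
- exact: rel (Srel_sum A pi) (eval_fsum p _ Wfin) (rmorph1 p).
apply: esym.
exact: rel (Srel_sum A pi) (eval_fsum_infinite p Winf one_neq0) (rmorph1 p).
Qed.

(** A relation moving e_i past 1_l is given only for l in W pi; when only
    l + alpha_i is in W pi it comes from the relation with the idempotent on
    the other side, and when neither is, both sides are 0. *)
Lemma respects_S_rels : S_rels A pi e f one.
Proof.
have shift_e i l : p (Sfree_e A pi i) * one l =
    one (l + sroot A i) * p (Sfree_e A pi i).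
  have [Wl|Wl] := pselect (Wpi l).
    exact: rel (Srel_eone i Wl) (evalM erefl erefl) (evalM erefl erefl).
  have [Wm|Wm] := pselect (Wpi (l + sroot A i)); last first.
    by rewrite !one_out0 // raddf0 mulr0 mul0r.
  have := rel (Srel_onee i Wm) (evalM erefl erefl) (evalM erefl erefl).
  by rewrite addrK => /esym.
have shift_f i l : p (Sfree_f A pi i) * one l =
    one (l - sroot A i) * p (Sfree_f A pi i).
  have [Wl|Wl] := pselect (Wpi l).
    exact: rel (Srel_fone i Wl) (evalM erefl erefl) (evalM erefl erefl).
  have [Wm|Wm] := pselect (Wpi (l - sroot A i)); last first.
    by rewrite !one_out0 // raddf0 mulr0 mul0r.
  have := rel (Srel_onef i Wm) (evalM erefl erefl) (evalM erefl erefl).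
  by rewrite subrK => /esym.
have comm_ef i j := rel (Srel_ef A pi i j)
  (evalB (evalM erefl erefl) (evalM erefl erefl)) erefl.
split=> //.
- move=> i l; rewrite comm_ef eqxx.
  have [Wl|/(one_out S_ones) ->] := pselect (Wpi l); last first.
    by rewrite mulr0 mul0rz.
  have [Wfin|/(one_degenerate S_ones) one0] := pselect (finite_set Wpi).
    apply: (eval_diag (fun l : weight n => l 0 i)) => // m.
    exact: (one_mul S_ones).
  by rewrite -[LHS]mulr1 -[RHS]mulr1 one0 !mulr0.
- move=> i j ij; apply/eqP; rewrite -subr_eq0 comm_ef (negbTE ij).
  by rewrite raddf0.
- move=> i j ij m; apply: (rel (Srel_serre_e A pi ij)); last exact: raddf0.
  apply: eval_sum => s; apply: evalZ (coef_rat _ _).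
  exact: evalM (evalM (evalX _ erefl) erefl) (evalX _ erefl).
move=> i j ij m; apply: (rel (Srel_serre_f A pi ij)); last exact: raddf0.
apply: eval_sum => s; apply: evalZ (coef_rat _ _).
exact: evalM (evalM (evalX _ erefl) erefl) (evalX _ erefl).
Qed.

End Respects.

Lemma S_rels_respects :
  S_rels A pi e f one -> forall x y, Srel A pi x y -> p x = p y.
Proof.
move=> [ones e_one f_one ef ef_neq serre_e serre_f].
have sum1 : p (\sum_(l \in Wpi) Sfree_one A pi l) = 1.
  have [Wfin|Winf] := pselect (finite_set Wpi).
    by rewrite eval_fsum // (one_sum ones).
  by rewrite eval_fsum_infinite // (one_degenerate ones).
have eval x y a b : p x = a -> p y = b -> a = b -> p x = p y by move=> -> -> ->.
move=> _ _ [l m _ _||i j|i l _|i l _|i l _|i l _|i j ij m|i j ij m].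
- apply: eval (evalM erefl erefl) erefl _.
  by rewrite (one_mul ones); case: eqP => // _; rewrite raddf0.
- by rewrite sum1 rmorph1.
- apply: eval (evalB (evalM erefl erefl) (evalM erefl erefl)) erefl _.
  have [<-|ij] := eqVneq i j; last by rewrite ef_neq // subrr raddf0.
  apply: (eq_on_weights ones) => l Wl; rewrite ef.
  have [Wfin|/(one_degenerate ones) one0] := pselect (finite_set Wpi).
    apply/esym/(eval_diag (fun l : weight n => l 0 i)) => // m.
    exact: (one_mul ones).
  by rewrite -[LHS]mulr1 -[RHS]mulr1 one0 !mulr0.
- exact: eval (evalM erefl erefl) (evalM erefl erefl) (e_one i l).
- exact: eval (evalM erefl erefl) (evalM erefl erefl) (f_one i l).
- by apply: eval (evalM erefl erefl) (evalM erefl erefl) _; rewrite e_one subrK.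
- by apply: eval (evalM erefl erefl) (evalM erefl erefl) _; rewrite f_one addrK.
- apply: eval _ _ (serre_e i j ij); last exact: raddf0.
  apply: eval_sum => s; apply: evalZ (coef_rat _ _).
  exact: evalM (evalM (evalX _ erefl) erefl) (evalX _ erefl).
apply: eval _ _ (serre_f i j ij); last exact: raddf0.
apply: eval_sum => s; apply: evalZ (coef_rat _ _).
exact: evalM (evalM (evalX _ erefl) erefl) (evalX _ erefl).
Qed.

End EvalS.

Section EvalT.
Variables (n : nat) (A : 'M[int]_n) (pi : set (weight n)).
Local Notation Wpi := (weyl_orbits A pi).
Local Notation alpha := (sroot A).
Variables (R : pzRingType) (p : {rmorphism freealg int (Tgen A pi) -> R}).
Local Notation e := (fun i a => p (Tfree_e A pi i a)).
Local Notation f := (fun i b => p (Tfree_f A pi i b)).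
Local Notation one := (fun l => p (Tfree_one A pi l)).

Let one_neq0 l : Wpi l -> Tfree_one A pi l != 0.
Proof.
move=> Wl; rewrite /Tfree_one; case: insubP => [u _ _|].
  by rewrite monalgU_eq0 oner_eq0.
by rewrite mem_set.
Qed.

Let one_out0 l : ~ Wpi l -> Tfree_one A pi l = 0.
Proof.
rewrite /Tfree_one; case: insubP => //= u Wl _ /=; case.
exact: set_mem Wl.
Qed.

Let intE (c : int) : c = c%:~R :> int.
Proof. by rewrite intz. Qed.

Let natE (c : nat) : c%:R = c%:Z%:~R :> int.
Proof. by rewrite intz natz. Qed.

Section Respects.
Hypothesis p_rel : forall x y, Trel A pi x y -> p x = p y.

Let rel x y a b : Trel A pi x y -> p x = a -> p y = b -> a = b.
Proof. by move=> /p_rel xy <- <-. Qed.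

Let T_ones : one_rels A pi one.
Proof.
split=> [l Wl|l m|Wfin|Winf].
- by rewrite one_out0 // raddf0.
- have [Wl|Wl] := pselect (Wpi l); last first.
    by rewrite one_out0 // raddf0 mul0r if_same.
  have [Wm|Wm] := pselect (Wpi m); last first.
    by rewrite (one_out0 Wm) raddf0 mulr0; case: eqP => // lm; rewrite lm in Wl.
  have := p_rel (Trel_idem Wl Wm); rewrite (evalM erefl erefl) => ->.
  by case: eqP; rewrite ?raddf0.
- exact: rel (Trel_sum A pi) (eval_fsum p _ Wfin) (rmorph1 p).
apply: esym.
exact: rel (Trel_sum A pi) (eval_fsum_infinite p Winf one_neq0) (rmorph1 p).
Qed.

Lemma respects_T_rels : T_rels A pi e f one.
Proof.
split=> //.
- move=> i a b; rewrite pmulrn.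
  exact: rel (Trel_ee A pi i a b) (evalM erefl erefl)
    (evalZ erefl (natE _)).
- move=> i a b; rewrite pmulrn.
  exact: rel (Trel_ff A pi i a b) (evalM erefl erefl)
    (evalZ erefl (natE _)).
- by move=> i; apply: rel (Trel_e0 A pi i) erefl (rmorph1 p).
- by move=> i; apply: rel (Trel_f0 A pi i) erefl (rmorph1 p).
- move=> i j a b ij.
  exact: rel (Trel_ef A pi a b ij) (evalM erefl erefl) (evalM erefl erefl).
- move=> i a b l.
  apply: rel (Trel_eonef A pi i a b l) (evalM (evalM erefl erefl) erefl) _.
  apply: eval_sum => t; exact: evalZ (evalM (evalM erefl erefl) erefl) (intE _).
- move=> i a b l.
  apply: rel (Trel_fonee A pi i a b l) (evalM (evalM erefl erefl) erefl) _.
  apply: eval_sum => t; exact: evalZ (evalM (evalM erefl erefl) erefl) (intE _).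
- move=> i a l; have [Wl|Wl] := pselect (Wpi l).
    exact: rel (Trel_eone i a Wl) (evalM erefl erefl) (evalM erefl erefl).
  have [Wm|Wm] := pselect (Wpi (l + a%:Z *: alpha i)); last first.
    by rewrite !one_out0 // raddf0 mulr0 mul0r.
  have := rel (Trel_onee i a Wm) (evalM erefl erefl) (evalM erefl erefl).
  by rewrite addrK => /esym.
- move=> i b l; have [Wl|Wl] := pselect (Wpi l).
    exact: rel (Trel_fone i b Wl) (evalM erefl erefl) (evalM erefl erefl).
  have [Wm|Wm] := pselect (Wpi (l - b%:Z *: alpha i)); last first.
    by rewrite !one_out0 // raddf0 mulr0 mul0r.
  have := rel (Trel_onef i b Wm) (evalM erefl erefl) (evalM erefl erefl).
  by rewrite subrK => /esym.
- move=> i j ij m; apply: (rel (Trel_serre_e A pi ij)); last exact: raddf0.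
  apply: eval_sum => s.
  exact: evalZ (evalM (evalM erefl erefl) erefl) (intE _).
move=> i j ij m; apply: (rel (Trel_serre_f A pi ij)); last exact: raddf0.
apply: eval_sum => s.
exact: evalZ (evalM (evalM erefl erefl) erefl) (intE _).
Qed.

End Respects.

Lemma T_rels_respects :
  T_rels A pi e f one -> forall x y, Trel A pi x y -> p x = p y.
Proof.
move=> [ones ee ff e0 f0 ef eonef fonee e_one f_one serre_e serre_f].
have sum1 : p (\sum_(l \in Wpi) Tfree_one A pi l) = 1.
  have [Wfin|Winf] := pselect (finite_set Wpi).
    by rewrite eval_fsum // (one_sum ones).
  by rewrite eval_fsum_infinite // (one_degenerate ones).
have eval x y a b : p x = a -> p y = b -> a = b -> p x = p y by move=> -> -> ->.
move=> _ _ [l m _ _||i a b|i a b|i|i|i j a b ij|i a b l|i a b l|i a l _|i b l _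
  |i a l _|i b l _|i j ij m|i j ij m].
- apply: eval (evalM erefl erefl) erefl _.
  by rewrite (one_mul ones); case: eqP => // _; rewrite raddf0.
- by rewrite sum1 rmorph1.
- exact: eval (evalM erefl erefl) (evalZ erefl (natE _)) (ee i a b).
- exact: eval (evalM erefl erefl) (evalZ erefl (natE _)) (ff i a b).
- exact: eval erefl (rmorph1 p) (e0 i).
- exact: eval erefl (rmorph1 p) (f0 i).
- exact: eval (evalM erefl erefl) (evalM erefl erefl) (ef i j a b ij).
- apply: eval (evalM (evalM erefl erefl) erefl) _ (eonef i a b l).
  apply: eval_sum => t; exact: evalZ (evalM (evalM erefl erefl) erefl) (intE _).
- apply: eval (evalM (evalM erefl erefl) erefl) _ (fonee i a b l).
  apply: eval_sum => t; exact: evalZ (evalM (evalM erefl erefl) erefl) (intE _).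
- exact: eval (evalM erefl erefl) (evalM erefl erefl) (e_one i a l).
- exact: eval (evalM erefl erefl) (evalM erefl erefl) (f_one i b l).
- by apply: eval (evalM erefl erefl) (evalM erefl erefl) _; rewrite e_one subrK.
- by apply: eval (evalM erefl erefl) (evalM erefl erefl) _; rewrite f_one addrK.
- apply: eval _ _ (serre_e i j ij); last exact: raddf0.
  apply: eval_sum => s; exact: evalZ (evalM (evalM erefl erefl) erefl) (intE _).
apply: eval _ _ (serre_f i j ij); last exact: raddf0.
apply: eval_sum => s; exact: evalZ (evalM (evalM erefl erefl) erefl) (intE _).
Qed.

End EvalT.

Section UniversalProperties.
Variables (n : nat) (A : 'M[int]_n) (pi : set (weight n)) (R : pzRingType).

Lemma S_lift (iota : {rmorphism rat -> R}) (e f : 'I_n -> R)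
    (one : weight n -> R) :
    (forall c x, GRing.comm (iota c) x) -> S_rels A pi e f one ->
  exists phi : {rmorphism Salg A pi -> R},
    [/\ forall c x, phi (c *: x) = iota c * phi x,
        forall i, phi (Se A pi i) = e i,
        forall i, phi (Sf A pi i) = f i
      & forall l, phi (Sone A pi l) = one l].
Proof.
move=> iotaC rels.
pose h (g : Sgen A pi) := match g with
  | SgenE i => e i | SgenF i => f i | SgenOne l => one (val l) end.
pose p : {rmorphism freealg rat (Sgen A pi) -> R} :=
  freeeval_rmorphism h iotaC.
have pe : (fun i => p (Sfree_e A pi i)) = e.
  by apply/funext => i; apply: freeeval_gen.
have pf : (fun i => p (Sfree_f A pi i)) = f.
  by apply/funext => i; apply: freeeval_gen.
have pone : (fun l => p (Sfree_one A pi l)) = one.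
  apply/funext => l; rewrite /Sfree_one.
  case: insubP => [u _ <-|/negP Wl]; first exact: freeeval_gen.
  by rewrite raddf0 (one_out (S_one rels)) // => /mem_set.
have p_rel x y : Srel A pi x y -> p x = p y.
  by apply: S_rels_respects; rewrite pe pf pone.
exists (preslift_rmorphism iotaC p_rel).
split=> [c x|i|i|l].
- exact (presliftZ iotaC p_rel c x).
- rewrite -[in RHS]pe; exact (prespiK iotaC p_rel _).
- rewrite -[in RHS]pf; exact (prespiK iotaC p_rel _).
rewrite -[in RHS]pone; exact (prespiK iotaC p_rel _).
Qed.

Lemma T_lift (e f : 'I_n -> nat -> R) (one : weight n -> R) :
    T_rels A pi e f one ->
  exists psi : {rmorphism ZTalg A pi -> R},
    [/\ forall i a, psi (prespi _ (Tfree_e A pi i a)) = e i a,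
        forall i b, psi (prespi _ (Tfree_f A pi i b)) = f i b
      & forall l, psi (prespi _ (Tfree_one A pi l)) = one l].
Proof.
move=> rels.
pose h (g : Tgen A pi) := match g with
  | TgenE i a => e i a | TgenF i b => f i b | TgenOne l => one (val l) end.
have intC (c : int) (x : R) : GRing.comm c%:~R x.
  exact/commr_sym/commr_int.
pose p : {rmorphism freealg int (Tgen A pi) -> R} :=
  freeeval_rmorphism h intC.
have pe : (fun i a => p (Tfree_e A pi i a)) = e.
  by apply/funext => i; apply/funext => a; apply: freeeval_gen.
have pf : (fun i b => p (Tfree_f A pi i b)) = f.
  by apply/funext => i; apply/funext => a; apply: freeeval_gen.
have pone : (fun l => p (Tfree_one A pi l)) = one.
  apply/funext => l; rewrite /Tfree_one.
  case: insubP => [u _ <-|/negP Wl]; first exact: freeeval_gen.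
  by rewrite raddf0 (one_out (T_one rels)) // => /mem_set.
have p_rel x y : Trel A pi x y -> p x = p y.
  by apply: T_rels_respects; rewrite pe pf pone.
exists (preslift_rmorphism intC p_rel).
split=> [i a|i b|l].
- rewrite -[in RHS]pe; exact (prespiK intC p_rel _).
- rewrite -[in RHS]pf; exact (prespiK intC p_rel _).
rewrite -[in RHS]pone; exact (prespiK intC p_rel _).
Qed.

End UniversalProperties.

(** * Q-algebras and extension of scalars *)

Section TensorInjections.
Variables B C : pzRingType.

Definition tens_inl (b : B) : tensor B C := tens b 1.
Definition tens_inr (c : C) : tensor B C := tens 1 c.

Let tensl (c : C) : zmod_morphism (fun b : B => tens b c).
Proof.
by move=> x y; apply/eqP; rewrite eq_sym subr_eq -tensDl subrK.
Qed.

Let tensr (b : B) : zmod_morphism (fun c : C => tens b c).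
Proof.
by move=> x y; apply/eqP; rewrite eq_sym subr_eq -tensDr subrK.
Qed.

HB.instance Definition _ :=
  GRing.isZmodMorphism.Build B (tensor B C) tens_inl (tensl 1).
HB.instance Definition _ :=
  GRing.isZmodMorphism.Build C (tensor B C) tens_inr (tensr 1).

Lemma tens_inl_monoid_morphism : monoid_morphism tens_inl.
Proof. by split=> // x y; rewrite /tens_inl tensM mulr1. Qed.

Lemma tens_inr_monoid_morphism : monoid_morphism tens_inr.
Proof. by split=> // x y; rewrite /tens_inr tensM mulr1. Qed.

HB.instance Definition _ :=
  GRing.isMonoidMorphism.Build B (tensor B C) tens_inl tens_inl_monoid_morphism.
HB.instance Definition _ :=
  GRing.isMonoidMorphism.Build C (tensor B C) tens_inr tens_inr_monoid_morphism.

Lemma tens_inlr b c : tens_inl b * tens_inr c = tens b c.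
Proof. by rewrite /tens_inl /tens_inr tensM mulr1 mul1r. Qed.

End TensorInjections.

Lemma tens_inl_central (B : comPzRingType) (C : pzRingType) (b : B)
    (x : tensor B C) : GRing.comm (tens_inl C b) x.
Proof.
rewrite /GRing.comm; elim/tens_ind: x => [b' c|x y xb yb].
  by rewrite /tens_inl !tensM mul1r mulr1 mulrC.
by rewrite mulrBl mulrBr xb yb.
Qed.

Section DividedPowers.
Variables (G : choiceType) (rel : freealg rat G -> freealg rat G -> Prop).
Local Notation S := (presalg rel).

Definition divpow (z : S) (m : nat) : S := m`!%:R^-1 *: z ^+ m.

Lemma divpowE z m : divpow z m *+ m`! = z ^+ m.
Proof.
rewrite -scaler_nat scalerA divff ?scale1r // pnatr_eq0 -lt0n.
exact: fact_gt0.
Qed.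

Lemma divpow1 z : divpow z 1 = z.
Proof. by rewrite /divpow expr1 invr1 scale1r. Qed.

Lemma presalg_rat_torsion_free m : injective (fun z : S => z *+ m.+1).
Proof.
move=> z w; rewrite -!scaler_nat => /(congr1 (fun u => m.+1%:R^-1 *: u)).
by rewrite !scalerA mulVf ?pnatr_eq0 // !scale1r.
Qed.

Variables (R : pzRingType) (iota : {rmorphism rat -> R}).
Variable phi : {rmorphism S -> R}.
Hypothesis phiZ : forall c x, phi (c *: x) = iota c * phi x.

(** What makes phi send e^m/m! to e^(m): division by m! is possible in any ring
    that receives Q. *)
Lemma rmorph_divpow z m w : phi z ^+ m = w *+ m`! -> phi (divpow z m) = w.
Proof.
move=> zw; rewrite phiZ rmorphXn /= zw mulrnAr -mulrnAl -rmorphMn /=.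
by rewrite -mulr_natr mulVf ?rmorph1 ?mul1r // pnatr_eq0 -lt0n fact_gt0.
Qed.

End DividedPowers.

Section ScalarExtension.
Variables (G : choiceType) (rel : freealg rat G -> freealg rat G -> Prop).
Variables (B : pzRingType) (psi : {rmorphism B -> presalg rel}).

Definition tens_extend (t : tensor rat B) : presalg rel :=
  tens_lift (fun q b => q *: psi b) t.

Let extendDl q1 q2 b : (q1 + q2) *: psi b = q1 *: psi b + q2 *: psi b.
Proof. exact: scalerDl. Qed.

Let extendDr q b1 b2 : q *: psi (b1 + b2) = q *: psi b1 + q *: psi b2.
Proof. by rewrite raddfD scalerDr. Qed.

Lemma tens_extendU q b : tens_extend (tens q b) = q *: psi b.
Proof. exact: tens_liftU. Qed.

Lemma tens_extendB : zmod_morphism tens_extend.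
Proof. exact: tens_liftB. Qed.

Lemma tens_extendM : {morph tens_extend : t u / t * u}.
Proof.
move=> t u; elim/tens_ind: t => [q b|t t' IHt IHt']; last first.
  by rewrite mulrBl !tens_extendB IHt IHt' mulrBl.
elim/tens_ind: u => [q' b'|u u' IHu IHu']; last first.
  by rewrite mulrBr !tens_extendB IHu IHu' mulrBr.
rewrite tensM !tens_extendU rmorphM -presalg_scaleAl -presalg_scaleAr.
by rewrite scalerA.
Qed.

Variable phi : {rmorphism presalg rel -> tensor rat B}.
Hypothesis phiZ : forall c x, phi (c *: x) = tens_inl B c * phi x.

(** Both [phi] and the extension of [psi] are Q-linear, and B spans the tensor
    product over Q. *)
Lemma tens_extend_can :
  (forall b, phi (psi b) = tens_inr rat b) -> cancel tens_extend phi.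
Proof.
move=> phi_psi; elim/tens_ind => [q b|x y xK yK].
  by rewrite tens_extendU phiZ phi_psi tens_inlr.
by rewrite tens_extendB raddfB /= xK yK.
Qed.

(** Both maps are morphisms of Q-algebras, so generators suffice. *)
Lemma can_tens_extend :
    (forall g, tens_extend (phi (prespi rel (freegen rat g))) =
       prespi rel (freegen rat g)) ->
  cancel phi tens_extend.
Proof.
move=> gK; elim/presalg_ind => [g||x y xK yK|x y xK yK|c x xK].
- exact: gK.
- by rewrite rmorph1 -tens11 tens_extendU rmorph1 scale1r.
- by rewrite raddfB /= tens_extendB xK yK.
- by rewrite rmorphM /= tens_extendM xK yK.
rewrite phiZ tens_extendM xK tens_extendU rmorph1.
by rewrite -presalg_scaleAl mul1r.
Qed.

End ScalarExtension.

(** * The isomorphism *)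

Lemma Salg_rels (n : nat) (A : 'M[int]_n) (pi : set (weight n)) :
  S_rels A pi (Se A pi) (Sf A pi) (Sone A pi).
Proof.
apply: (@respects_S_rels _ _ _ _ (prespi (Srel A pi))) => x y rxy.
by apply/prespiP/asboolP/ideal_gen_gen.
Qed.

Definition tens1 (n : nat) (A : 'M[int]_n) (pi : set (weight n)) :
  {rmorphism ZTalg A pi -> Talg A pi} := @tens_inr rat (ZTalg A pi).

Lemma Talg_rels (n : nat) (A : 'M[int]_n) (pi : set (weight n)) :
  T_rels A pi (fun i a => tens1 A pi (prespi _ (Tfree_e A pi i a)))
    (fun i b => tens1 A pi (prespi _ (Tfree_f A pi i b)))
    (fun l => tens1 A pi (prespi _ (Tfree_one A pi l))).
Proof.
apply: (@respects_T_rels _ _ _ _ (tens1 A pi \o prespi (Trel A pi))) => x y rxy.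
by congr (tens1 _ _ _); apply/prespiP/asboolP/ideal_gen_gen.
Qed.

Lemma ZT_range (n : nat) (A : 'M[int]_n) (pi : set (weight n)) :
  ZT A pi = range (tens1 A pi).
Proof.
apply/seteqP; split=> [y|_ [x _ <-]]; last by apply: zspan_gen; exists x.
elim=> {y} [y [x _ <-]||y z _ [x _ <-] _ [x' _ <-]].
- by exists x.
- by exists 0 => //; rewrite raddf0.
by exists (x - x') => //; rewrite raddfB.
Qed.

(** By [T_gen_one], the idempotents lie in the subring generated by the divided
    powers. *)
Lemma ZTalg_ind (n : nat) (A : 'M[int]_n) (pi : set (weight n))
    (P : ZTalg A pi -> Prop) : (forall i, A i i = 2) ->
    (forall i a, P (prespi _ (Tfree_e A pi i a))) ->
    (forall i b, P (prespi _ (Tfree_f A pi i b))) ->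
    P 1 -> (forall x y, P x -> P y -> P (x - y)) ->
    (forall x y, P x -> P y -> P (x * y)) ->
  forall x, P x.
Proof.
move=> A_diag Pe Pf P1 PB PM.
have ZTrels := @respects_T_rels _ A pi _ (prespi (Trel A pi))
  (fun x y rxy => elimT (prespiP _ _ _) (asboolT (ideal_gen_gen rxy))).
apply: presalg_int_ind => // -[i a|i b|l]; [exact: Pe | exact: Pf |].
have := T_gen_one A_diag ZTrels P1 PB PM Pe Pf (val l).
by rewrite /Tfree_one valK.
Qed.

Theorem theorem8p6 (n : nat) (A : 'M[int]_n) (A_fin : cartan_finite_type A)
    (pi : set (weight n)) (pi_fin : finite_set pi) (pi_sat : saturated A pi) :
  exists phi : {rmorphism Salg A pi -> Talg A pi},
    [/\ scalable phi,
        bijective phi,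
        forall i, phi (Se A pi i) = Te A pi i,
        forall i, phi (Sf A pi i) = Tf A pi i
      & forall l, weyl_orbits A pi l -> phi (Sone A pi l) = Tone A pi l] /\
    phi @` ZS A pi = ZT A pi.
Proof.
have [A_diag _ _] := A_fin.
have TT := Talg_rels A pi; have SS := Salg_rels A pi.
pose iota : {rmorphism rat -> Talg A pi} := @tens_inl rat (ZTalg A pi).
have iotaC (c : rat) (x : Talg A pi) : GRing.comm (iota c) x.
  exact: tens_inl_central.
have [phi [phiZ phi_e phi_f phi_one]] :=
  S_lift iotaC (T_rels_S_rels A_diag TT).
have ST := S_rels_T_rels A_diag (@presalg_rat_torsion_free _ (Srel A pi))
  (@divpowE _ (Srel A pi)) SS.
have [psi [psi_e psi_f psi_one]] := T_lift (R := Salg A pi) ST.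
have phi_dpe i a :
  phi (divpow (Se A pi i) a) = tens1 A pi (prespi _ (Tfree_e A pi i a)).
  apply: (rmorph_divpow phiZ); rewrite phi_e.
  exact: (divided_powE _ (T_ee TT i) (T_e0 TT i)).
have phi_dpf i b :
  phi (divpow (Sf A pi i) b) = tens1 A pi (prespi _ (Tfree_f A pi i b)).
  apply: (rmorph_divpow phiZ); rewrite phi_f.
  exact: (divided_powE _ (T_ff TT i) (T_f0 TT i)).
have phi_psi x : phi (psi x) = tens1 A pi x.
  move: x.
  apply: (@ZTalg_ind n A pi (fun x => phi (psi x) = tens1 A pi x) A_diag)
    => [i a|i b||x y px py|x y px py].
  - by rewrite psi_e phi_dpe.
  - by rewrite psi_f phi_dpf.
  - by rewrite !rmorph1.
  - by rewrite !raddfB /= px py.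
  - by rewrite !rmorphM /= px py.
pose Psi : Talg A pi -> Salg A pi := tens_extend psi.
have PsiJ x : Psi (tens1 A pi x) = psi x.
  exact (etrans (tens_extendU psi 1 x) (scale1r _)).
have phiK : cancel phi Psi.
  apply: (can_tens_extend phiZ) => -[i|i|l].
  - by rewrite -/(Se A pi i) phi_e [LHS]PsiJ psi_e divpow1.
  - by rewrite -/(Sf A pi i) phi_f [LHS]PsiJ psi_f divpow1.
  have -> : prespi (Srel A pi) (freegen rat (SgenOne l)) = Sone A pi (val l).
    by rewrite /Sone /Sfree_one valK.
  by rewrite phi_one [LHS]PsiJ psi_one.
have PsiK : cancel Psi phi := tens_extend_can phiZ phi_psi.
have psi_ZS x : ZS A pi (psi x).
  move: x; apply: (@ZTalg_ind n A pi (fun x => ZS A pi (psi x)) A_diag)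
    => [i a|i b||x y px py|x y px py].
  - by rewrite psi_e; apply: subring_gen_gen; exists i, a; left.
  - by rewrite psi_f; apply: subring_gen_gen; exists i, b; right.
  - by rewrite rmorph1; apply: subring_gen1.
  - by rewrite raddfB; apply: subring_genB.
  - by rewrite rmorphM; apply: subring_genM.
exists phi; split; first split.
- by move=> c x; exact (phiZ c x).
- by exists Psi; [exact phiK | exact PsiK].
- exact phi_e.
- exact phi_f.
- by move=> l _; exact (phi_one l).
rewrite ZT_range; apply/seteqP; split=> [_ [x ZSx <-]|_ [x _ <-]]; last first.
  by exists (psi x); [exact (psi_ZS x) | exact (phi_psi x)].
elim: ZSx => {x} [x [i [m [->|->]]]||x y _ [x' _ jx] _ [y' _ jy]
  |x y _ [x' _ jx] _ [y' _ jy]].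
- by exists (prespi _ (Tfree_e A pi i m)); last exact (esym (phi_dpe i m)).
- by exists (prespi _ (Tfree_f A pi i m)); last exact (esym (phi_dpf i m)).
- by exists 1; last by rewrite !rmorph1.
- by exists (x' - y'); last by rewrite !raddfB /= jx jy.
by exists (x' * y'); last by rewrite !rmorphM /= jx jy.
Qed.
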